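(* The following problem is PSPACE-hard: given a regular transition system $\mathcal{R} = \langle \Sigma, \mathcal{I}, \mathcal{T}\rangle$ and an NFA $\mathcal{U}$ over $\Sigma$, decide whether $\mathit{IndInv}_1 \cap L(\mathcal{U}) = \emptyset$.
   Context: All alphabets are finite. $L(\mathcal{U})$ is the language of the NFA $\mathcal{U}$. For words $w, u \in \Sigma^*$ of the same length $\ell$, $\langle w,u\rangle$ denotes the word $\langle w[1],u[1]\rangle \cdots \langle w[\ell],u[\ell]\rangle \in (\Sigma\times\Sigma)^*$. A (length-preserving) transducer over $\Sigma\times\Sigma$ is an NFA over the alphabet $\Sigma \times \Sigma$. A regular transition system (RTS) is a triple $\langle \Sigma, \mathcal{I}, \mathcal{T}\rangle$ with $\Sigma$ an alphabet, $\mathcal{I}$ an NFA over $\Sigma$, and $\mathcal{T}$ a transducer over $\Sigma\times\Sigma$. Words over $\Sigma$ are configurations; those accepted by $\mathcal{I}$ are initial; $w \leadsto u$ means that $|w|=|u|$ and $\langle w,u\rangle$ is accepted by $\mathcal{T}$. A set $S\subseteq\Sigma^*$ is inductive if $w\in S$ and $w\leadsto u$ imply $u\in S$. For $\ell\ge 0$, $\mathit{AP}_\ell$ is the set of atomic propositions $q_{j:\ell}$ with $q\in\Sigma$, $j\in[1,\ell]$. A $1$-formula over $\mathit{AP}_\ell$ is either $\mathit{true}$ or a single clause, i.e. a disjunction of atomic propositions of $\mathit{AP}_\ell$ and constants $\mathit{true},\mathit{false}$ (the empty clause is $\mathit{false}$). A configuration of length $\ell$ satisfies $q_{j:\ell}$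 iff its $j$-th letter is $q$, with the usual extension to disjunctions; every configuration of length different from $\ell$ satisfies every formula over $\mathit{AP}_\ell$. A formula is inductive if the set of configurations satisfying it is inductive. For configurations $u,w$, write $u \stackrel{*}{\leadsto}_1 w$ if every inductive $1$-formula (over any $\mathit{AP}_\ell$) satisfied by $u$ is also satisfied by $w$. Let $\mathit{IndInv}_1 = \{w\in\Sigma^*\mid u \stackrel{*}{\leadsto}_1 w \text{ for some initial configuration } u\}$. *)

(* Defs.v *)
From mathcomp Require Import all_boot.
Set Implicit Arguments.
Unset Strict Implicit.
Unset Printing Implicit Defensive.

(** * Automata and regular transition systems *)

(* The sets of initial states, final states and transitions are given by
   listings; order and repetitions do not affect the accepted language. *)
Record nfa (A : Type) := NFA {
  nfa_states : nat;
  nfa_init : seq 'I_nfa_states;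
  nfa_final : seq 'I_nfa_states;
  nfa_trans : seq ('I_nfa_states * A * 'I_nfa_states)
}.

Fixpoint accepts_from (A : eqType) (N : nfa A) (q : 'I_(nfa_states N))
    (w : seq A) : bool :=
  if w is a :: w' then
    [exists q', ((q, a, q') \in nfa_trans N) && accepts_from q' w']
  else q \in nfa_final N.

Definition accepts (A : eqType) (N : nfa A) (w : seq A) : bool :=
  [exists q, (q \in nfa_init N) && accepts_from q w].

Record rts (A : Type) := RTS {
  rts_init : nfa A;
  rts_trans : nfa (A * A)
}.

Definition rts_step (A : finType) (R : rts A) (w u : seq A) : Prop :=
  size w = size u /\ accepts (rts_trans R) (zip w u).

Definition inductive_set (A : finType) (R : rts A) (S : seq A -> Prop) : Prop :=
  forall w u, S w -> rts_step R w u -> S u.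

(** * Inductive 1-formulas *)

(* Positions are numbered from 0: [Atom q j] is the proposition "the letter at
   position j+1 is q". *)
Inductive literal (A : Type) (l : nat) :=
  | Atom of A & 'I_l
  | Const of bool.

Inductive formula1 (A : Type) (l : nat) :=
  | True1
  | Clause of seq (literal A l).

Definition sat_literal (A : eqType) (l : nat) (w : seq A) (x : literal A l)
    : bool :=
  match x with
  | Atom q j => onth w j == Some q
  | Const b => b
  end.

Definition sat (A : eqType) (l : nat) (w : seq A) (phi : formula1 A l) : bool :=
  (size w == l) ==>
    (if phi is Clause c then has (sat_literal w) c else true).

Definition inductive_formula (A : finType) (R : rts A) (l : nat)
    (phi : formula1 A l) : Prop :=
  inductive_set R (fun w => sat w phi).

Definition reach1 (A : finType) (R : rts A) (u w : seq A) : Prop :=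
  forall (l : nat) (phi : formula1 A l),
    inductive_formula R phi -> sat u phi -> sat w phi.

Definition IndInv1 (A : finType) (R : rts A) (w : seq A) : Prop :=
  exists2 u, accepts (rts_init R) u & reach1 R u w.

(** * Turing machines *)

Inductive move := MoveLeft | Stay | MoveRight.

(* A two-way infinite tape: the scanned cell, and the cells visited so far (or
   initially holding the input) on either side of it, nearest first. All other
   cells are blank. *)
Record tape (S : Type) := Tape { tleft : seq S; thead : S; tright : seq S }.

Definition tape_cells (S : Type) (t : tape S) : seq S :=
  rev (tleft t) ++ thead t :: tright t.

Definition tape_write (S : Type) (s : S) (t : tape S) : tape S :=
  Tape (tleft t) s (tright t).

Definition tape_move (S : Type) (blank : S) (m : move) (t : tape S) : tape S :=
  let: Tape l h r := t in
  match m with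
  | MoveLeft => Tape (behead l) (head blank l) (h :: r)
  | Stay => t
  | MoveRight => Tape (h :: l) (head blank r) (behead r)
  end.

(* [None] is the blank, [Some (inl b)] a bit, [Some (inr c)] an auxiliary
   symbol of the machine. *)
Definition symbol (C : Type) : Type := option (bool + C).

(* Deterministic machines with [k.+1] tapes. A state is halting when
   [tm_verdict] is [Some b], and then it accepts iff [b]. *)
Record tm (k : nat) := TM {
  tm_state : finType;
  tm_aux : finType;
  tm_start : tm_state;
  tm_verdict : tm_state -> option bool;
  tm_delta : tm_state -> {ffun 'I_k.+1 -> symbol tm_aux} ->
             tm_state * {ffun 'I_k.+1 -> symbol tm_aux * move}
}.

Record config (k : nat) (M : tm k) := Config {
  cstate : tm_state M;
  ctapes : {ffun 'I_k.+1 -> tape (symbol (tm_aux M))}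
}.

Definition tm_step (k : nat) (M : tm k) (c : config M) : config M :=
  if tm_verdict (cstate c) is Some _ then c else
  let: (q, act) := tm_delta (cstate c) [ffun i => thead (ctapes c i)] in
  @Config k M q
    [ffun i => tape_move None (act i).2 (tape_write (act i).1 (ctapes c i))].

Definition bits (C : Type) (x : seq bool) : seq (symbol C) :=
  [seq Some (inl b) | b <- x].

Definition input_tape (C : Type) (x : seq bool) : tape (symbol C) :=
  Tape [::] (head None (bits C x)) (behead (bits C x)).

Definition blank_tape (C : Type) : tape (symbol C) := Tape [::] None [::].

Definition tm_init (k : nat) (M : tm k) (x : seq bool) : config M :=
  @Config k M (tm_start M)
    [ffun i => if i == ord0 then input_tape _ x else blank_tape _].

Definition tm_run (k : nat) (M : tm k) (x : seq bool) (t : nat) : config M :=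
  iter t (@tm_step k M) (tm_init M x).

(* The last tape (the input tape, if there is only one) holds the word [y] and
   is otherwise blank. *)
Definition tm_output (k : nat) (M : tm k) (c : config M) (y : seq bool) : Prop :=
  exists a b : nat,
    tape_cells (ctapes c ord_max) = nseq a None ++ bits _ y ++ nseq b None.

(** * Polynomial space, polynomial-time reductions, hardness *)

Definition language := seq bool -> Prop.

(* The class does not depend on the number of tapes; space is measured on
   one-tape machines. *)
Definition PSPACE (L : language) : Prop :=
  exists (M : tm 0) (c d : nat), forall x : seq bool,
    (exists (t : nat) (b : bool),
        tm_verdict (cstate (tm_run M x t)) = Some b /\ (b <-> L x)) /\
    (forall t : nat,
        size (tape_cells (ctapes (tm_run M x t) ord0)) <= c * size x ^ d + c).

Definition polytime (f : seq bool -> seq bool) : Prop :=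
  exists (k : nat) (M : tm k) (c d : nat), forall x : seq bool,
    exists t : nat,
      [/\ t <= c * size x ^ d + c,
          tm_verdict (cstate (tm_run M x t)) <> None &
          tm_output (tm_run M x t) (f x)].

Definition poly_reducible (L L' : language) : Prop :=
  exists2 f, polytime f & forall x, L x <-> L' (f x).

Definition PSPACE_hard (L' : language) : Prop :=
  forall L, PSPACE L -> poly_reducible L L'.

Definition language_of (T : Type) (enc : T -> seq bool) (P : T -> Prop)
    : language :=
  fun y => exists2 x, enc x = y & P x.

(** * The decision problem *)

Record instance := Instance {
  alphabet_size : nat;
  system : rts 'I_alphabet_size;
  automaton : nfa 'I_alphabet_size
}.

Definition IndInv1_disjoint (p : instance) : Prop :=
  forall w, ~ (IndInv1 (system p) w /\ accepts (automaton p) w).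

(* Letters and states are written in unary, as is usual when the size of an
   automaton is at least its numbers of letters and states. *)
Definition enc_nat (n : nat) : seq bool := rcons (nseq n true) false.

Definition enc_ord (n : nat) (i : 'I_n) : seq bool := enc_nat i.

Definition enc_pair (A B : Type) (ea : A -> seq bool) (eb : B -> seq bool)
    (p : A * B) : seq bool :=
  ea p.1 ++ eb p.2.

Fixpoint enc_seq (A : Type) (ea : A -> seq bool) (s : seq A) : seq bool :=
  if s is x :: s' then true :: ea x ++ enc_seq ea s' else [:: false].

Definition enc_nfa (A : Type) (ea : A -> seq bool) (N : nfa A) : seq bool :=
  enc_nat (nfa_states N) ++
  enc_seq (@enc_ord _) (nfa_init N) ++
  enc_seq (@enc_ord _) (nfa_final N) ++
  enc_seq (enc_pair (enc_pair (@enc_ord _) ea) (@enc_ord _)) (nfa_trans N).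

Definition enc_instance (p : instance) : seq bool :=
  enc_nat (alphabet_size p) ++
  enc_nfa (@enc_ord _) (rts_init (system p)) ++
  enc_nfa (enc_pair (@enc_ord _) (@enc_ord _)) (rts_trans (system p)) ++
  enc_nfa (@enc_ord _) (automaton p).

(** ** The encoding is injective *)

Definition prefix_code (A : Type) (ea : A -> seq bool) : Prop :=
  forall x y s t, ea x ++ s = ea y ++ t -> x = y /\ s = t.

Lemma enc_nat_prefix : prefix_code enc_nat.
Proof.
rewrite /enc_nat; elim=> [|m IH] [|n] s t //=; first by case.
by case=> /IH[-> ->].
Qed.

Lemma enc_ord_prefix n : prefix_code (@enc_ord n).
Proof. by move=> i j s t /enc_nat_prefix[/val_inj-> ->]. Qed.

Lemma enc_pair_prefix (A B : Type) (ea : A -> seq bool) (eb : B -> seq bool) :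
  prefix_code ea -> prefix_code eb -> prefix_code (enc_pair ea eb).
Proof.
move=> pa pb [a b] [a' b'] s t; rewrite /enc_pair /= -!catA.
by case/pa=> -> /pb[-> ->].
Qed.

Lemma enc_seq_prefix (A : Type) (ea : A -> seq bool) :
  prefix_code ea -> prefix_code (enc_seq ea).
Proof.
move=> pa; elim=> [|x r IH] [|y r'] s t //=; first by case.
by rewrite -!catA => -[/pa[-> /IH[-> ->]]].
Qed.

Lemma enc_nfa_prefix (A : Type) (ea : A -> seq bool) :
  prefix_code ea -> prefix_code (enc_nfa ea).
Proof.
move=> pa [n i f d] [n' i' f' d'] s t; rewrite /enc_nfa /= -!catA.
case/enc_nat_prefix=> en; case: n' / en i' f' d' => i' f' d'.
case/(enc_seq_prefix (@enc_ord_prefix _)) => ->.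
case/(enc_seq_prefix (@enc_ord_prefix _)) => ->.
have pt := enc_pair_prefix (enc_pair_prefix (@enc_ord_prefix n) pa)
                           (@enc_ord_prefix n).
by case/(enc_seq_prefix pt) => -> ->.
Qed.

Lemma enc_instance_inj : injective enc_instance.
Proof.
move=> [n [i d] u] [n' [i' d'] u']; rewrite /enc_instance /=.
case/enc_nat_prefix=> en; case: n' / en i' d' u' => i' d' u'.
have po := @enc_ord_prefix n.
case/(enc_nfa_prefix po) => ->.
case/(enc_nfa_prefix (enc_pair_prefix po po)) => ->.
rewrite -[enc_nfa _ u]cats0 -[enc_nfa _ u']cats0.
by case/(enc_nfa_prefix po) => ->.
Qed.

(* Main.v *)
From mathcomp Require Import all_boot zify.
Require Import Defs.

(** Configurations are words over cells of a Turing machine [M] (a tape symbol,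
    with the state on the scanned cell) and one more letter [ok]. A computation
    of [M] on [x] is written as a single word: its space-time diagram, row after
    row, starting with an initial word of [D] letters (the first row and one more
    letter). The rows overlap like a helix, so that the letter at position [p + D]
    is a function of the letters at positions [p], [p + 1], [p + 2]; the padding
    of the initial word keeps the head away from the ends of the rows.

    One step of the system changes one letter into [ok], at a position [p + D]
    where this local rule holds, the three letters of the window being different
    from [ok]; the transducer guesses [p] and counts to [D]. The initial
    configurations are [Sigma^D ok^*], and the automaton [U] accepts the words that
    start with the initial word of [x], avoid [ok] and end in a rejecting cell.
    If a word of [U] follows the rule everywhere, it is reached from an initial
    configuration by adding the letters in place of [ok] from left to right. If it
    violates the rule at [p + D], the clause that excludes exactly the words with
    letters [w_i] or [ok] at each [i <> p + D] and [w_(p+D)] at [p + D] is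
    inductive, holds initially and fails at [w]. Hence [IndInv1] meets [L(U)] iff
    [M] rejects [x].

    The machine computing the reduction is compiled from programs with bounded
    loops over tapes to which letters are only appended. *)

Set Implicit Arguments.
Unset Strict Implicit.
Unset Printing Implicit Defensive.

(** * Polynomially bounded functions *)

Definition poly_bounded (f : nat -> nat) : Prop :=
  exists c d, forall n, f n <= c * n ^ d + c.

(** The summand [1] covers [n = 0], where [0 ^ 0 = 1] exceeds [0 ^ d'] for positive [d']. *)
Lemma leq_expn_succ n d d' : d <= d' -> n ^ d <= n ^ d' + 1.
Proof.
case: n => [|n] dd; last by rewrite -[X in X <= _]addn0 leq_add // leq_pexp2l.
by apply: leq_trans (leq_addl _ 1); case: d dd => [|d] _; rewrite ?expn0 ?exp0n.
Qed.

Lemma poly_bounded_le f g :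
  (forall n, f n <= g n) -> poly_bounded g -> poly_bounded f.
Proof. by move=> fg [c [d gp]]; exists c, d => n; apply: leq_trans (gp n). Qed.

Lemma poly_bounded_const c : poly_bounded (fun=> c).
Proof. by exists c, 0 => n; lia. Qed.

Lemma poly_bounded_id : poly_bounded id.
Proof. by exists 1, 1 => n; lia. Qed.

Lemma poly_bounded_add f g :
  poly_bounded f -> poly_bounded g -> poly_bounded (fun n => f n + g n).
Proof.
move=> [c [d fp]] [c' [d' gp]]; exists (2 * (c + c')), (maxn d d') => n.
have := fp n; have := gp n.
have := leq_expn_succ n (leq_maxl d d'); have := leq_expn_succ n (leq_maxr d d').
move: (n ^ _) (n ^ d) (n ^ d') => e e1 e2; nia.
Qed.

Lemma poly_bounded_mul f g :
  poly_bounded f -> poly_bounded g -> poly_bounded (fun n => f n * g n).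
Proof.
(* Up to the factor [c * c'], each of the four terms of the product is at most
   [n ^ (d + d') + 1]. *)
move=> [c [d fp]] [c' [d' gp]]; exists (4 * (c * c')), (d + d') => n.
apply: leq_trans (leq_mul (fp n) (gp n)) _.
have := leq_expn_succ n (leq_addr d' d); have := leq_expn_succ n (leq_addl d d').
rewrite mulnDl !mulnDr mulnACA -expnD.
move: (n ^ (d + d')) (n ^ d) (n ^ d') => e e1 e2; nia.
Qed.

Lemma poly_bounded_exp f d :
  poly_bounded f -> poly_bounded (fun n => f n ^ d).
Proof.
move=> fp; elim: d => [|d IH]; first exact: poly_bounded_const.
by apply: poly_bounded_le (poly_bounded_mul fp IH) => n; rewrite expnS.
Qed.

Lemma poly_bounded_comp f g :
  poly_bounded f -> poly_bounded g -> poly_bounded (fun n => f (g n)).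
Proof.
move=> [c [d fp]] gp; apply: poly_bounded_le (fun n => fp (g n)) _.
apply: poly_bounded_add (poly_bounded_const c).
exact: poly_bounded_mul (poly_bounded_const c) (poly_bounded_exp d gp).
Qed.

Lemma poly_bounded_sum (I : finType) (f : I -> nat -> nat) :
  (forall i, poly_bounded (f i)) -> poly_bounded (fun n => \sum_i f i n).
Proof.
move=> fp; elim: index_enum => [|i r IH].
  by apply: poly_bounded_le (poly_bounded_const 0) => n; rewrite big_nil.
by apply: poly_bounded_le (poly_bounded_add (fp i) IH) => n; rewrite big_cons.
Qed.

(** * Machine fragments *)

Section Machine.

Variable k : nat.

Definition letter : finType := (bool + bool)%type.
Definition tapes : Type := {ffun 'I_k.+1 -> tape (symbol bool)}.
Definition actions : Type := {ffun 'I_k.+1 -> symbol bool * move}.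

(* A machine whose transitions may leave it; control then passes to whatever
   follows, without an extra step. *)
Record fragment := Fragment {
  fstate : finType;
  fstart : fstate;
  fdelta : fstate -> {ffun 'I_k.+1 -> symbol bool} -> option fstate * actions
}.

Definition scan (tp : tapes) : {ffun 'I_k.+1 -> symbol bool} :=
  [ffun i => thead (tp i)].

Definition act (a : actions) (tp : tapes) : tapes :=
  [ffun i => tape_move None (a i).2 (tape_write (a i).1 (tp i))].

(** The index counts machine steps, including the exiting transition, whose actions are still
    carried out. *)
Inductive exec (f : fragment) : nat -> fstate f -> tapes -> tapes -> Prop :=
| exec_exit q tp : (fdelta q (scan tp)).1 = None ->
    exec 1 q tp (act (fdelta q (scan tp)).2 tp)
| exec_step n q q' tp tp' : (fdelta q (scan tp)).1 = Some q' ->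
    exec n q' (act (fdelta q (scan tp)).2 tp) tp' -> exec n.+1 q tp tp'.

Definition tape_act (s : symbol bool) (m : move) (t : tape (symbol bool)) :=
  tape_move None m (tape_write s t).

Definition on_tape (r : 'I_k.+1) (s : symbol bool) (m : move)
    (sc : {ffun 'I_k.+1 -> symbol bool}) : actions :=
  [ffun i => if i == r then (s, m) else (sc i, Stay)].

Lemma act_on_tape r s m (tp : tapes) i :
  act (on_tape r s m (scan tp)) tp i =
  if i == r then tape_act s m (tp i) else tp i.
Proof. by rewrite !ffunE; case: eqP => // _; case: (tp i). Qed.

Lemma act_stay r (tp : tapes) : act (on_tape r (scan tp r) Stay (scan tp)) tp = tp.
Proof.
apply/ffunP=> i; rewrite act_on_tape; case: eqP => // ->.
by rewrite ffunE; case: (tp r).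
Qed.

(** * A language of append-only tapes *)

Inductive cmd :=
| Skip
| Emit of 'I_k.+1 & letter
| Seq of cmd & cmd
| For of 'I_k.+1 & (letter -> cmd).

Definition store : Type := {ffun 'I_k.+1 -> seq letter}.

Definition app (st : store) (r : 'I_k.+1) (s : seq letter) : store :=
  [ffun i => if i == r then st i ++ s else st i].

Fixpoint run (c : cmd) (st : store) : store :=
  match c with
  | Skip => st
  | Emit r a => app st r [:: a]
  | Seq c1 c2 => run c2 (run c1 st)
  | For r b => foldl (fun st' a => run (b a) st') st (st r)
  end.

Fixpoint uses (c : cmd) (i : 'I_k.+1) : bool :=
  match c with
  | Skip => false
  | Emit r _ => i == r
  | Seq c1 c2 => uses c1 i || uses c2 i
  | For r b => (i == r) || [exists a, uses (b a) i]
  end.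

Fixpoint loops (c : cmd) (i : 'I_k.+1) : bool :=
  match c with
  | Skip | Emit _ _ => false
  | Seq c1 c2 => loops c1 i || loops c2 i
  | For r b => (i == r) || [exists a, loops (b a) i]
  end.

(** While a loop runs, the head of its tape marks the current letter, so the body must leave that
    tape alone. *)
Fixpoint wf (c : cmd) : bool :=
  match c with
  | Skip | Emit _ _ => true
  | Seq c1 c2 => wf c1 && wf c2
  | For r b => [forall a, ~~ uses (b a) r && wf (b a)]
  end.

(** Here [P] bounds the contents of the tapes looped over. A loop rewinds in at most [P + 2] steps,
    spends two steps per letter on dispatch and advance, and exits in one; the sum over all letters
    bounds the body for whichever letter is read. *)
Fixpoint time (c : cmd) (P : nat) : nat :=
  match c with
  | Skip | Emit _ _ => 1
  | Seq c1 c2 => time c1 P + time c2 P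
  | For r b => P + 3 + P * (2 + \sum_a time (b a) P)
  end.

Lemma time_poly c : poly_bounded (time c).
Proof.
elim: c => [|r a|c1 IH1 c2 IH2|r b IH] /=.
- exact: poly_bounded_const.
- exact: poly_bounded_const.
- exact: poly_bounded_add.
apply: poly_bounded_add.
  exact: poly_bounded_add poly_bounded_id (poly_bounded_const 3).
apply: poly_bounded_mul poly_bounded_id _.
apply: poly_bounded_add (poly_bounded_const 2) _.
exact: poly_bounded_sum.
Qed.

(** Contents only grow, so a bound on the final contents of a tape holds throughout the run. *)
Lemma run_monotone c (st : store) i : size (st i) <= size (run c st i).
Proof.
elim: c st => [|r a|c1 IH1 c2 IH2|r b IH] st //=.
- by rewrite ffunE; case: eqP => // _; rewrite size_cat leq_addr.
- exact: leq_trans (IH1 _) (IH2 _).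
elim: (st r) {1 2}st => [|a s IHs] st' //=.
exact: leq_trans (IH a st') (IHs _).
Qed.

Lemma foldl_monotone (b : letter -> cmd) s (st : store) i :
  size (st i) <= size (foldl (fun st' a => run (b a) st') st s i).
Proof.
elim: s st => [|a s IHs] st //=.
exact: leq_trans (run_monotone (b a) st i) (IHs _).
Qed.

Lemma run_unused c (st : store) i : ~~ uses c i -> run c st i = st i.
Proof.
elim: c st => [|r a|c1 IH1 c2 IH2|r b IH] st //=.
- by rewrite ffunE => /negbTE->.
- by rewrite negb_or => /andP[u1 u2]; rewrite IH2 // IH1.
rewrite negb_or negb_exists => /andP[_ /forallP u].
by elim: (st r) {1 3}st => [|a s IHs] st' //=; rewrite IHs IH.
Qed.

(** * Compilation *)

Definition skip_fragment : fragment :=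
  @Fragment unit tt (fun _ sc => (None, on_tape ord0 (sc ord0) Stay sc)).

Definition emit_fragment (r : 'I_k.+1) (a : letter) : fragment :=
  @Fragment unit tt (fun _ sc => (None, on_tape r (Some a) MoveRight sc)).

(** The input tape starts with its head on the first letter, whereas compiled programs expect the
    head behind the contents. *)
Definition seek_fragment (r : 'I_k.+1) : fragment :=
  @Fragment unit tt (fun _ sc =>
    if sc r is Some a then (Some tt, on_tape r (Some a) MoveRight sc)
    else (None, on_tape r None Stay sc)).

Definition seq_fragment (f g : fragment) : fragment :=
  @Fragment (fstate f + fstate g)%type (inl (fstart f)) (fun q sc =>
    match q with
    | inl q => let: (o, a) := fdelta q sc in
               (Some (if o is Some q' then inl q' else inr (fstart g)), a)
    | inr q => let: (o, a) := fdelta q sc in (omap inr o, a)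
    end).

(* Entering with the head behind the contents of [r], the states are: start,
   rewinding, dispatch on the scanned letter, advance to the next letter. *)
Definition for_fragment (r : 'I_k.+1) (b : letter -> fragment) : fragment :=
  @Fragment ((bool * bool) + {a : letter & fstate (b a)})%type
   (inl (false, false)) (fun q sc =>
    match q with
    | inl (false, false) =>
        (Some (inl (false, true)), on_tape r (sc r) MoveLeft sc)
    | inl (false, true) =>
        if sc r is Some a then
          (Some (inl (false, true)), on_tape r (sc r) MoveLeft sc)
        else (Some (inl (true, false)), on_tape r (sc r) MoveRight sc)
    | inl (true, false) =>
        if sc r is Some a then
          (Some (inr (Tagged (fun a => fstate (b a)) (fstart (b a)))),
           on_tape r (sc r) Stay sc)
        else (None, on_tape r (sc r) Stay sc)
    | inl (true, true) =>
        (Some (inl (true, false)), on_tape r (sc r) MoveRight sc)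
    | inr q =>
        let: (o, act) := fdelta (tagged q) sc in
        (Some (if o is Some q' then inr (Tagged (fun a => fstate (b a)) q')
               else inl (true, true)), act)
    end).

Fixpoint compile (c : cmd) : fragment :=
  match c with
  | Skip => skip_fragment
  | Emit r a => emit_fragment r a
  | Seq c1 c2 => seq_fragment (compile c1) (compile c2)
  | For r b => for_fragment r (fun a => compile (b a))
  end.

(** The head stands between [s1] and [s2], on the first letter of [s2] or on the blank behind the
    contents. The numbers [a] and [b] absorb the blanks that happen to be recorded at the two
    ends. *)
Definition holds (s1 s2 : seq letter) (t : tape (symbol bool)) : Prop :=
  exists a b, t = Tape (rev (map Some s1) ++ nseq a None)
                       (head None (map Some s2 ++ nseq b None))
                       (behead (map Some s2 ++ nseq b None)).

Lemma holds_thead s1 s2 t : holds s1 s2 t -> thead t = head None (map Some s2).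
Proof. by move=> [a [b ->]] /=; case: s2 => //=; case: b. Qed.

Lemma holds_right s1 x s2 t :
  holds s1 (x :: s2) t -> holds (rcons s1 x) s2 (tape_act (Some x) MoveRight t).
Proof. by move=> [a [b ->]]; exists a, b; rewrite map_rcons rev_rcons. Qed.

Lemma holds_left s1 x s2 t :
  holds (rcons s1 x) s2 t -> holds s1 (x :: s2) (tape_act (thead t) MoveLeft t).
Proof.
move=> [a [b ->]]; rewrite map_rcons rev_rcons /tape_act /=.
case: s2 => [|y s2] /=; last by exists a, b.
(* Leaving the blank behind the contents records it, even if none was recorded before. *)
by case: b => [|b]; [exists a, 1 | exists a, b.+1].
Qed.

(** The end of rewinding: the blank before the contents stops the head, and one move to the right
    brings it to the first letter. *)
Lemma holds_bounce s2 t t' :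
  holds [::] s2 t -> t' = tape_act (thead t) MoveLeft t ->
  thead t' = None /\ holds [::] s2 (tape_act None MoveRight t').
Proof.
move=> [a [b ->]] -> /=; rewrite /tape_act /=; split; first by case: a.
(* The visit records a blank on the left if there was none. *)
exists (if a is 0 then 1 else a), b => /=.
by case: a => [|a] //=.
Qed.

Lemma holds_emit s x t :
  holds s [::] t -> holds (rcons s x) [::] (tape_act (Some x) MoveRight t).
Proof.
move=> [a [b ->]]; exists a, b.-1; rewrite map_rcons rev_rcons.
by rewrite /tape_act /=; case: b => [|[|b]].
Qed.

(** Heads stand behind the contents before and after. The last clause is a frame condition, which
    makes fragments composable. *)
Definition implements (f : fragment) (c : cmd) : Prop :=
  forall (tp : tapes) (st : store) P,
    (forall i, uses c i -> holds (st i) [::] (tp i)) ->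
    (forall i, loops c i -> size (run c st i) <= P) ->
  exists n (tp' : tapes), [/\ exec n (fstart f) tp tp', n <= time c P,
    forall i, uses c i -> holds (run c st i) [::] (tp' i) &
    forall i, ~~ uses c i -> tp' i = tp i].

(** The transition by which [f] exits becomes the entry into [g], so no step is added. *)
Lemma exec_seql (f g : fragment) n m q tp tp1 tp2 :
  exec (f := f) n q tp tp1 -> exec (f := g) m (fstart g) tp1 tp2 ->
  exec (f := seq_fragment f g) (n + m) (inl q) tp tp2.
Proof.
move=> e1 e2.
have lift m' q' tp' tp'' : exec (f := g) m' q' tp' tp'' ->
    exec (f := seq_fragment f g) m' (inr q') tp' tp''.
  elim=> {m' q' tp' tp''} [q' tp' E|m' q' q'' tp' tp'' E _ IH].
    by have /= := @exec_exit (seq_fragment f g) (inr q') tp';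
       move: E; case: fdelta => o a /= -> /(_ erefl).
  have /= := @exec_step (seq_fragment f g) m' (inr q') (inr q'') tp' tp''.
  by move: E IH; case: fdelta => o a /= -> IH /(_ erefl IH).
elim: e1 e2 => {n q tp tp1} [q tp E|n q q' tp tp1 E _ IH] e2.
  have /= := @exec_step (seq_fragment f g) m (inl q) (inr (fstart g)) tp tp2.
  by move: E e2; case: fdelta => o a /= -> e2 /(_ erefl (lift _ _ _ _ e2)).
have /= := @exec_step (seq_fragment f g) (n + m) (inl q) (inl q') tp tp2.
by move: E IH; case: fdelta => o a /= -> IH /(_ erefl (IH e2)).
Qed.

Lemma implements_seq f g c1 c2 :
  implements f c1 -> implements g c2 ->
  implements (seq_fragment f g) (Seq c1 c2).
Proof.
move=> i1 i2 tp st P h b.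
have [||n1 [tp1 [e1 t1 h1 u1]]] := i1 tp st P.
- by move=> i ui; apply: h; rewrite /= ui.
- move=> i li; apply: leq_trans (b i _); first exact: run_monotone.
  by rewrite /= li.
have [||n2 [tp2 [e2 t2 h2 u2]]] := i2 tp1 (run c1 st) P.
- move=> i ui; case: (boolP (uses c1 i)) => [/h1//|n1i].
  by rewrite u1 // run_unused //; apply: h; rewrite /= ui orbT.
- by move=> i li; apply: b; rewrite /= li orbT.
exists (n1 + n2), tp2; split; first exact: exec_seql e1 e2.
- exact: leq_add.
- move=> i /= ui; case: (boolP (uses c2 i)) => [/h2//|n2i].
  rewrite u2 // (run_unused _ n2i); apply: h1.
  by move: ui; rewrite (negbTE n2i) orbF.
by move=> i /=; rewrite negb_or => /andP[n1i n2i]; rewrite u2 // u1.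
Qed.

(** * Correctness and running time of loops *)

Section ForLoop.

Variables (r : 'I_k.+1) (b : letter -> fragment).
Let F := for_fragment r b.

Lemma exec_for_body a n m q tp tp1 tp2 :
  exec (f := b a) n q tp tp1 ->
  exec (f := F) m (inl (true, true)) tp1 tp2 ->
  exec (f := F) (n + m) (inr (Tagged (fun a => fstate (b a)) q)) tp tp2.
Proof.
move=> e1 e2; elim: e1 e2 => {n q tp tp1} [q tp E|n q q' tp tp1 E _ IH] e2.
  have /= := @exec_step F m (inr (Tagged (fun a => fstate (b a)) q))
                        (inl (true, true)) tp tp2.
  by move: E e2; case: fdelta => o x /= -> e2 /(_ erefl e2).
have /= := @exec_step F (n + m) (inr (Tagged (fun a => fstate (b a)) q))
                      (inr (Tagged (fun a => fstate (b a)) q')) tp tp2.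
by move: E IH; case: fdelta => o x /= -> IH /(_ erefl (IH e2)).
Qed.

(** The tape [t0] is the one before the last move, so the head is now on the last letter of [s1], or
    on the blank before the contents. The execution that follows is a parameter because [exec]
    covers only executions that exit, which rewinding does not. *)
Lemma exec_for_rewind s1 s2 t0 (tp : tapes) :
  holds s1 s2 t0 -> tp r = tape_act (thead t0) MoveLeft t0 ->
  exists tp1 : tapes, [/\ holds [::] (s1 ++ s2) (tp1 r),
     forall i, i != r -> tp1 i = tp i &
     forall n tp', exec (f := F) n (inl (true, false)) tp1 tp' ->
       exec (f := F) (size s1 + n.+1) (inl (false, true)) tp tp'].
Proof.
elim/last_ind: s1 s2 t0 tp => [|s1 x IH] s2 t0 tp h0 Er.
  have [hd hr] := holds_bounce h0 Er.
  exists (act (on_tape r None MoveRight (scan tp)) tp); split.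
  - by rewrite act_on_tape eqxx.
  - by move=> i; rewrite act_on_tape => /negbTE->.
  move=> n tp' e; apply: (@exec_step F _ _ (inl (true, false))) => /=.
    by rewrite ffunE hd.
  by rewrite ffunE hd.
have h1 := holds_left h0; rewrite -Er in h1.
have hd := holds_thead h1; rewrite /= in hd.
pose tp1 := act (on_tape r (Some x) MoveLeft (scan tp)) tp.
have [|tp2 [h2 u2 e2]] := IH (x :: s2) (tp r) tp1 h1.
  by rewrite act_on_tape eqxx hd.
rewrite -cat_rcons in h2; exists tp2; split => //.
  by move=> i ir; rewrite u2 // act_on_tape (negbTE ir).
move=> n tp' e; rewrite size_rcons.
apply: (@exec_step F _ _ (inl (false, true))) => /=.
  by rewrite ffunE hd.
by rewrite ffunE hd; apply: e2.
Qed.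

Variable c : letter -> cmd.
Hypothesis bc : forall a, implements (b a) (c a).
Hypothesis cr : forall a, ~~ uses (c a) r.

Let usesb i := [exists a, uses (c a) i].

(** Induction on the letters [s2] still to be read. The body leaves the head of [r] in place since
    [c a] does not use [r]. *)
Lemma exec_for_scan s2 s1 (tp : tapes) (st : store) P :
  holds s1 s2 (tp r) ->
  (forall i, usesb i -> holds (st i) [::] (tp i)) ->
  (forall i a, loops (c a) i ->
     size (foldl (fun st' a => run (c a) st') st s2 i) <= P) ->
  exists n (tp' : tapes), [/\ exec (f := F) n (inl (true, false)) tp tp',
    n <= 1 + size s2 * (2 + \sum_a time (c a) P),
    holds (s1 ++ s2) [::] (tp' r) &
    (forall i, usesb i ->
      holds (foldl (fun st' a => run (c a) st') st s2 i) [::] (tp' i)) /\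
    (forall i, i != r -> ~~ usesb i -> tp' i = tp i)].
Proof.
elim: s2 s1 tp st => [|x s2 IH] s1 tp st hr hb bd.
  have hs : scan tp r = None by rewrite ffunE (holds_thead hr).
  exists 1, tp; split => //; last by rewrite cats0.
  have := @exec_exit F (inl (true, false)) tp.
  by rewrite /= hs /= -hs act_stay; apply.
have hs : scan tp r = Some x by rewrite ffunE (holds_thead hr).
have rb : ~~ usesb r by rewrite negb_exists; apply/forallP.
have [||n1 [tp1 [e1 t1 h1 u1]]] := bc (a := x) (tp := tp) (st := st) (P := P).
- by move=> i ui; apply: hb; apply/existsP; exists x.
- move=> i li; apply: leq_trans (bd i x li).
  exact: (foldl_monotone c).
have Er : tp1 r = tp r by apply: u1.
pose tp2 := act (on_tape r (Some x) MoveRight (scan tp1)) tp1.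
have u2 i : i != r -> tp2 i = tp1 i by rewrite act_on_tape => /negbTE->.
have hr2 : holds (rcons s1 x) s2 (tp2 r).
  by rewrite act_on_tape eqxx Er; apply: holds_right.
have [||n3 [tp3 [e3 t3 hr3 [h3 u3]]]] := IH _ _ (run (c x) st) hr2.
- move=> i ui; have ir : i != r by apply: contraNneq rb => <-.
  rewrite u2 //; case: (boolP (uses (c x) i)) => [/h1//|nx].
  by rewrite u1 // run_unused //; apply: hb.
- by move=> i a li; apply: (bd i a li).
(* The two extra steps are the dispatch on [x] and the advance past it. *)
exists (n1 + n3.+1).+1, tp3; split.
- have := @exec_step F (n1 + n3.+1) (inl (true, false))
    (inr (Tagged (fun a => fstate (b a)) (fstart (b x)))) tp tp3.
  rewrite /= hs /=; apply => //; rewrite -hs act_stay.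
  apply: exec_for_body e1 _.
  apply: (@exec_step F _ _ (inl (true, false))) => //=.
  by have -> : scan tp1 r = Some x by rewrite -hs !ffunE Er.
- have : time (c x) P <= \sum_a time (c a) P by rewrite (bigD1 x) //= leq_addr.
  move/(leq_trans t1); move: (\sum_a _) t3 => z t3 t4 /=; rewrite mulSn.
  move: (_ * _) t3 => y; lia.
- by rewrite -cat_rcons.
split=> // i ir nb; rewrite u3 // u2 // u1 //.
by apply: contra nb => ui; apply/existsP; exists x.
Qed.

Lemma implements_for : implements F (For r c).
Proof.
move=> tp st P h bd.
pose tp1 := act (on_tape r (scan tp r) MoveLeft (scan tp)) tp.
have u1 i : i != r -> tp1 i = tp i by rewrite act_on_tape => /negbTE->.
have rb : ~~ usesb r by rewrite negb_exists; apply/forallP.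
have h0 : holds (st r) [::] (tp r) by apply: h; rewrite /= eqxx.
have bdr : size (st r) <= P.
  by apply: leq_trans (bd r _); [exact: (run_monotone (For r c))|rewrite /= eqxx].
have Er : tp1 r = tape_act (thead (tp r)) MoveLeft (tp r).
  by rewrite act_on_tape eqxx ffunE.
have [tp2 [h2 u2 e2]] := exec_for_rewind h0 Er; rewrite cats0 in h2.
have [||n3 [tp3 [e3 t3 h3 [hb u3]]]] :=
  @exec_for_scan _ [::] tp2 st P h2.
- move=> i ui; have ir : i != r by apply: contraNneq rb => <-.
  by rewrite u2 // u1 //; apply: h; rewrite /= [X in _ || X]ui orbT.
- move=> i a li; apply: bd => /=; apply/orP; right.
  by apply/existsP; exists a.
exists (size (st r) + n3.+1).+1, tp3; split.
- by apply: (@exec_step F _ _ (inl (false, true))) => //=; apply: e2.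
- rewrite /=; move: (\sum_a _) t3 => z t3.
  have := leq_mul bdr (leqnn (2 + z)).
  move: (size _ * _) (P * _) t3 => y y'; move: (size _) bdr => l; lia.
- move=> i /= /orP[/eqP->|/hb//].
  suff -> : foldl (fun st' a => run (c a) st') st (st r) r = st r by [].
  elim: (st r) {1 3}st => [|a s IH] st' //=.
  by rewrite IH run_unused.
by move=> i /=; rewrite negb_or => /andP[ir nb]; rewrite u3 // u2 // u1.
Qed.

End ForLoop.

Lemma implements_compile c : wf c -> implements (compile c) c.
Proof.
elim: c => [|r a|c1 IH1 c2 IH2|r b IH] /=.
- move=> _ tp st P h _; exists 1, tp; split=> //.
  have := @exec_exit skip_fragment tt tp erefl.
  by rewrite /= act_stay.
- move=> _ tp st P h _; exists 1, (act (on_tape r (Some a) MoveRight (scan tp)) tp).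
  split=> //; first exact: (@exec_exit (emit_fragment r a) tt tp).
  + move=> i /= /eqP->; rewrite act_on_tape ffunE eqxx cats1.
    by apply: holds_emit; apply: h => /=.
  + by move=> i /= /negbTE ir; rewrite act_on_tape ir.
- by move=> /andP[w1 w2]; apply: implements_seq; [apply: IH1|apply: IH2].
move=> /forallP w; apply: implements_for => a.
  by apply: IH; have /andP[] := w a.
by have /andP[] := w a.
Qed.

(** * Complete machines and polynomial time *)

Lemma exec_seek r s2 s1 (tp : tapes) :
  holds s1 s2 (tp r) ->
  exists tp' : tapes, [/\ exec (f := seek_fragment r) (size s2).+1 tt tp tp',
    holds (s1 ++ s2) [::] (tp' r) & forall i, i != r -> tp' i = tp i].
Proof.
elim: s2 s1 tp => [|x s2 IH] s1 tp h.
  have hs : scan tp r = None by rewrite ffunE (holds_thead h).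
  exists tp; split; rewrite ?cats0 //.
  have := @exec_exit (seek_fragment r) tt tp.
  by rewrite /= hs /= -hs act_stay; apply.
have hs : scan tp r = Some x by rewrite ffunE (holds_thead h).
have [|tp' [e h' u]] :=
  IH (rcons s1 x) (act (on_tape r (Some x) MoveRight (scan tp)) tp).
  by rewrite act_on_tape eqxx; apply: holds_right.
exists tp'; split.
- have := @exec_step (seek_fragment r) (size s2).+1 tt tt tp tp'.
  by rewrite /= hs /=; apply.
- by rewrite -cat_rcons.
by move=> i ir; rewrite u // act_on_tape (negbTE ir).
Qed.

Definition machine (f : fragment) : tm k :=
  @TM k (option (fstate f)) bool (Some (fstart f))
    (fun q => if q is None then Some true else None)
    (fun q sc => if q is Some q' then fdelta q' sc
                 else (None, on_tape ord0 None Stay sc)).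

Lemma exec_machine f n q (tp tp' : tapes) :
  exec (f := f) n q tp tp' ->
  iter n (@tm_step k (machine f)) (@Config k (machine f) (Some q) tp) =
  @Config k (machine f) None tp'.
Proof.
elim=> {n q tp tp'} [q tp E|n q q' tp tp' E _ IH].
  rewrite /= /tm_step /=; move: E; rewrite /scan.
  by case: fdelta => o a /= ->.
rewrite iterSr -IH; congr (iter n _ _).
rewrite /tm_step /=; move: E; rewrite /scan.
by case: fdelta => o a /= ->.
Qed.

Definition input_store (x : seq bool) : store :=
  [ffun i => if i == ord0 then map inl x else [::]].

Lemma holds_input (x : seq bool) : holds [::] (map inl x) (input_tape bool x).
Proof.
exists 0, 0.
have -> : map Some (map inl x) = bits bool x by rewrite -map_comp.
by rewrite /= !cats0.
Qed.

Lemma run_polytime (c : cmd) (f : seq bool -> seq bool) (p : nat -> nat) :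
  wf c -> poly_bounded p ->
  (forall x, run c (input_store x) ord_max = map inl (f x)) ->
  (forall x i, loops c i -> size (run c (input_store x) i) <= p (size x)) ->
  polytime f.
Proof.
move=> wfc pp cf cp.
have [C [d Cd]] : poly_bounded (fun n => n + 1 + time c (p n)).
  apply: poly_bounded_add; last exact: poly_bounded_comp (time_poly c) pp.
  exact: poly_bounded_add poly_bounded_id (poly_bounded_const 1).
pose F := seq_fragment (seek_fragment ord0) (compile c).
exists k, (machine F), C, d => x.
pose tp0 : tapes := [ffun i => if i == ord0 then input_tape _ x else blank_tape _].
have [|tp1 [e1 h1 u1]] := @exec_seek ord0 (map inl x) [::] tp0.
  by rewrite ffunE eqxx; apply: holds_input.
have h i : holds (input_store x i) [::] (tp1 i).
  rewrite ffunE; case: eqP => [->//|/eqP i0].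
  by rewrite u1 // ffunE (negbTE i0); exists 0, 0.
have [|n [tp2 [e2 t2 h2 u2]]] :=
  implements_compile wfc (fun i _ => h i) (P := p (size x)); first exact: cp.
have h2' : holds (run c (input_store x) ord_max) [::] (tp2 ord_max).
  case: (boolP (uses c ord_max)) => [/h2//|nu].
  by rewrite u2 // run_unused.
have E := exec_machine (exec_seql e1 e2).
rewrite size_map in E.
exists ((size x).+1 + n); rewrite /tm_run E; split=> //.
  by apply: leq_trans (Cd _); rewrite addn1 leq_add.
(* The scanned cell is listed in any case, so at least one blank follows the output. *)
move: h2'; rewrite cf => -[a [b ht]]; exists a, (maxn 1 b).
have -> : bits bool (f x) = map Some (map inl (f x)) by rewrite -map_comp.
rewrite /= ht /tape_cells /= rev_cat revK rev_nseq -catA.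
by case: b {ht} => [|[|b]].
Qed.

End Machine.

(** * Automata with stages *)

Section Staged.

Variables (A Q : finType) (T : Type) (R0 RE : Q -> A -> Q -> bool).
Variables (RD : T -> Q -> A -> Q -> bool) (q0 qf : Q).

Definition width := #|Q|.+1.

Definition rules (R : Q -> A -> Q -> bool) : seq (Q * A * Q) :=
  enum [pred r | R r.1.1 r.1.2 r.2].

(** The source stage begins at number [m]; [e] is [width] for a rule that advances one stage and [0]
    for a rule that stays. *)
Definition shift (m e : nat) (r : Q * A * Q) : nat * A * nat :=
  (m + enum_rank r.1.1, r.1.2, m + (e + enum_rank r.2)).

Fixpoint chain (m : nat) (W : seq T) : seq (nat * A * nat) :=
  if W is t :: W' then map (shift m width) (rules (RD t)) ++ chain (m + width) W'
  else map (shift m 0) (rules RE).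

Definition ord_rule (n : nat) (r : nat * A * nat) : 'I_n.+1 * A * 'I_n.+1 :=
  (inord r.1.1, r.1.2, inord r.2).

(* The state [q] at stage [i <= size W] has number [width * i + enum_rank q]. *)
Definition staged (W : seq T) : nfa A :=
  @NFA A (width * size W + #|Q|).+1
    [:: inord (enum_rank q0)] [:: inord (width * size W + enum_rank qf)]
    [seq ord_rule _ r | r <- map (shift 0 0) (rules R0) ++ chain 0 W].

Variable W : seq T.

(** Acceptance in terms of pairs of a stage and a state, free of the numbering. The stages let the
    automaton count to [size W], and since each stage depends on one letter of [W], a single loop
    over [W] can print it. *)
Fixpoint staged_accepts (i : nat) (q : Q) (w : seq A) : Prop :=
  if w is a :: w' then
    exists q', [\/ [/\ i = 0, R0 q a q' & staged_accepts 0 q' w'],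
      exists t, [/\ onth W i = Some t, RD t q a q' & staged_accepts i.+1 q' w']
    | [/\ i = size W, RE q a q' & staged_accepts i q' w']]
  else i = size W /\ q = qf.

Definition code (i : nat) (q : Q) : 'I_(nfa_states (staged W)) :=
  inord (width * i + enum_rank q).

Lemma mem_rules R q a q' : ((q, a, q') \in rules R) = R q a q'.
Proof. by rewrite mem_enum. Qed.

Lemma mem_shift R m e r :
  (r \in map (shift m e) (rules R)) <->
  exists q a q', R q a q' /\ r = shift m e (q, a, q').
Proof.
split=> [/mapP[[[q a] q']]|[q [a [q' [h ->]]]]].
  by rewrite mem_rules => h ->; exists q, a, q'.
by apply: map_f; rewrite mem_rules.
Qed.

Lemma mem_chain r m (V : seq T) :
  r \in chain m V <->
  (exists i t q a q', [/\ onth V i = Some t, RD t q a q' &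
     r = shift (m + width * i) width (q, a, q')]) \/
  (exists q a q', RE q a q' /\ r = shift (m + width * size V) 0 (q, a, q')).
Proof.
elim: V m r => [|t V IH] m r /=.
  rewrite muln0 addn0 mem_shift; split=> [|[[i [t]]|]//]; first by right.
  by move=> [? [? [? []]]]; rewrite onth0n.
rewrite mem_cat; split.
  case/orP => [/mem_shift[q [a [q' [h ->]]]]|/IH[]].
  - by left; exists 0, t, q, a, q'; rewrite muln0 addn0.
  - move=> [i [t' [q [a [q' [h1 h2 ->]]]]]]; left; exists i.+1, t', q, a, q'.
    by rewrite mulnS addnA.
  - by move=> [q [a [q' [h ->]]]]; right; exists q, a, q'; rewrite mulnS addnA.
case=> [[[|i] [t' [q [a [q' [h1 h2 ->]]]]]]|[q [a [q' [h ->]]]]]; apply/orP.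
- left; rewrite muln0 addn0; apply/mem_shift; exists q, a, q'.
  by case: h1 h2 => ->.
- right; apply/IH; left; exists i, t', q, a, q'.
  by rewrite mulnS addnA.
by right; apply/IH; right; exists q, a, q'; rewrite mulnS addnA.
Qed.

Lemma code_bound i (q : Q) :
  i <= size W -> width * i + enum_rank q < (width * size W + #|Q|).+1.
Proof.
move=> iW; rewrite ltnS leq_add //; first by rewrite leq_mul2l iW orbT.
by apply: ltnW; apply: ltn_ord.
Qed.

Lemma code_inj i j (q q' : Q) :
  width * i + enum_rank q = width * j + enum_rank q' -> i = j /\ q = q'.
Proof.
have lt (x : Q) : enum_rank x < width by rewrite ltnS ltnW.
rewrite !(mulnC width) => E; have := congr1 (divn^~ width) E.
rewrite /= !divnMDl // !divn_small // !addn0 => ij; split=> //.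
by move: E; rewrite ij => /addnI/ord_inj/enum_rank_inj.
Qed.

Lemma onth_size_lt (V : seq T) i t : onth V i = Some t -> i < size V.
Proof. by move=> h; rewrite -onthTE h. Qed.

Lemma staged_transP i q a (s : 'I_(nfa_states (staged W))) :
  i <= size W ->
  reflect (exists q',
    [\/ [/\ i = 0, R0 q a q' & s = code 0 q'],
        exists t, [/\ onth W i = Some t, RD t q a q' & s = code i.+1 q']
      | [/\ i = size W, RE q a q' & s = code i q']])
  ((code i q, a, s) \in nfa_trans (staged W)).
Proof.
move=> iW; apply: (iffP idP).
  move=> /mapP[[[x y] z] hr]; rewrite /ord_rule /= => -[Ex Ey ->]; subst y.
  (* Numbers within the bound are not altered by [inord], so equal states have equal numbers. *)
  have inj j p : x = width * j + enum_rank p -> j <= size W -> i = j /\ q = p.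
    move=> xE jW; apply: code_inj; move/(congr1 val): Ex.
    by rewrite xE /= !inordK // code_bound.
  move: hr; rewrite mem_cat => /orP[/mem_shift|/mem_chain[]].
  - move=> [p [b [p' [h [E1 -> ->]]]]]; exists p'; constructor 1.
    have [||-> ->] // := inj 0 p; first by rewrite muln0.
    by rewrite /code muln0.
  - move=> [j [t [p [b [p' [h1 h2 [E1 -> ->]]]]]]]; exists p'; constructor 2.
    have [||-> ->] // := inj j p; first exact: ltnW (onth_size_lt h1).
    by exists t; rewrite /code mulnS add0n addnA (addnC width).
  move=> [p [b [p' [h [E1 -> ->]]]]]; exists p'; constructor 3.
  have [||-> ->] // := inj (size W) p.
move=> [q' []].
- move=> [-> h ->]; apply/mapP; exists (shift 0 0 (q, a, q')).
    by rewrite mem_cat; apply/orP; left; apply/mem_shift; exists q, a, q'.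
  by rewrite /ord_rule /code muln0.
- move=> [t [h1 h2 ->]]; apply/mapP.
  exists (shift (width * i) width (q, a, q')).
    rewrite mem_cat; apply/orP; right; apply/mem_chain; left.
    by exists i, t, q, a, q'.
  by rewrite /ord_rule /code /= mulnS addnA (addnC width).
move=> [-> h ->]; apply/mapP; exists (shift (width * size W) 0 (q, a, q')).
  rewrite mem_cat; apply/orP; right; apply/mem_chain; right.
  by exists q, a, q'.
by [].
Qed.

Lemma accepts_from_staged w i q :
  i <= size W -> accepts_from (code i q) w <-> staged_accepts i q w.
Proof.
elim: w i q => [|a w IH] i q iW /=.
  rewrite inE -val_eqE /= !inordK ?code_bound //; split.
    by move=> /eqP/code_inj.
  by move=> [-> ->].
split.
  move=> /existsP[s /andP[/(staged_transP _ _ _ iW)[q' h] ha]]; exists q'.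
  case: h ha => [[-> h ->]|[t [h1 h2 ->]]|[-> h ->]] ha.
  - by constructor 1; split=> //; apply/IH.
  - by constructor 2; exists t; split=> //; apply/IH => //; apply: onth_size_lt h1.
  - by constructor 3; split=> //; apply/IH.
move=> [q' h]; apply/existsP.
case: h => [[i0 h1 h2]|[t [h1 h2 h3]]|[iE h1 h2]].
- exists (code 0 q'); apply/andP; split; last by apply/IH.
  by apply/staged_transP => //; exists q'; constructor 1.
- exists (code i.+1 q'); apply/andP; split.
    by apply/staged_transP => //; exists q'; constructor 2; exists t.
  by apply/IH => //; apply: onth_size_lt h1.
exists (code i q'); apply/andP; split; last by apply/IH.
by apply/staged_transP => //; exists q'; constructor 3.
Qed.

Lemma accepts_staged w : accepts (staged W) w <-> staged_accepts 0 q0 w.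
Proof.
have E : inord (enum_rank q0) = code 0 q0 by rewrite /code muln0.
split.
  move=> /existsP[s /andP[]]; rewrite inE => /eqP->.
  by rewrite E => /accepts_from_staged; apply.
move=> h; apply/existsP; exists (code 0 q0).
by rewrite inE -E eqxx E; apply/accepts_from_staged.
Qed.

End Staged.

(** * The checking system *)

Section Checking.

Variables (S : finType) (T : Type) (ok : S).
Variables (chk : S -> S -> S -> S -> bool) (lett : T -> S) (bad : pred S).

Definition I_rule (q : unit) (a : S) (q' : unit) : bool := true.
Definition I_end (q : unit) (a : S) (q' : unit) : bool := a == ok.
Definition I_start (q : unit) (a : S) (q' : unit) : bool := false.

Definition init_nfa : seq T -> nfa S :=
  staged I_start I_end (fun=> I_rule) tt tt.

(** The state [true] is entered only by a final bad letter and has no outgoing rule. *)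
Definition U_rule (t : T) (q : bool) (a : S) (q' : bool) : bool :=
  [&& ~~ q, ~~ q' & a == lett t].
Definition U_end (q : bool) (a : S) (q' : bool) : bool :=
  ~~ q && (if q' then bad a else a != ok).
Definition U_start (q : bool) (a : S) (q' : bool) : bool := false.

Definition final_nfa : seq T -> nfa S :=
  staged U_start U_end U_rule false true.

(* The states are: before the window ([inl (inl (inl false))]), after one or two
   of its letters, waiting for the successor letter [e], done. *)
Definition T_state : finType := (bool + S + S * S + S)%type.

Definition T_start (q : T_state) (z : S * S) (q' : T_state) : bool :=
  match q, q' with
  | inl (inl (inl false)), inl (inl (inl false)) => z.1 == z.2
  | _, _ => false
  end.
(** The letter [e] is guessed with the third letter of the window. The stage counts letters from the
    start of the window, so the last stage is reached exactly at the letter to be replaced. *)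
Definition T_rule (q : T_state) (z : S * S) (q' : T_state) : bool :=
  match q, q' with
  | inl (inl (inl false)), inl (inl (inr a)) => z == (a, a)
  | inl (inl (inr a)), inl (inr (a', b)) => (a' == a) && (z == (b, b))
  | inl (inr (a, b)), inr e => (z.1 == z.2) && chk a b z.1 e
  | inr e, inr e' => (e' == e) && (z.1 == z.2)
  | _, _ => false
  end.
Definition T_end (q : T_state) (z : S * S) (q' : T_state) : bool :=
  match q, q' with
  | inr e, inl (inl (inl true)) => z == (ok, e)
  | inl (inl (inl true)), inl (inl (inl true)) => z.1 == z.2
  | _, _ => false
  end.

Definition step_nfa : seq T -> nfa (S * S) :=
  staged T_start T_end (fun=> T_rule) (inl (inl (inl false)))
    (inl (inl (inl true))).

(** * The languages of the three automata *)

Variable W : seq T.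
Let D := size W.

Lemma onthW i : i < D -> exists t, onth W i = Some t.
Proof. by rewrite /D -onthTE; case: onth => // t; exists t. Qed.

Lemma init_nfaP u :
  accepts (init_nfa W) u <->
  exists s m, size s = D /\ u = s ++ nseq m ok.
Proof.
rewrite accepts_staged.
suff gen i q : i <= D ->
  staged_accepts I_start I_end (fun=> I_rule) tt W i q u <->
  exists s m, size s = D - i /\ u = s ++ nseq m ok.
  by rewrite gen // subn0.
elim: u i q => [|a u IH] i q iD /=.
  split=> [[-> _]|[s [m []]]].
    by exists [::], 0; rewrite subnn.
  by case: s => //= sz _; split; [rewrite -/D; lia|case: q].
split.
  move=> [q' [[]//|[t [ht _]]|[iE /eqP-> ]]].
    have lt := onth_size_lt ht.
    move=> /IH[]// s [m [sz ->]]; exists (a :: s), m; split=> //=.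
    by rewrite sz; move: lt; rewrite -/D; lia.
  move=> /IH[]// s [m [sz ->]]; move: sz; rewrite iE subnn.
  by case: s => // _; exists [::], m.+1.
move=> [s [m []]]; case: s => [|b s] /= sz.
  case: m => // m [-> Eu]; exists tt; constructor 3; split.
  - by rewrite -/D; lia.
  - exact: eqxx.
  by apply/IH => //; exists [::], m.
have lt : i < D by lia.
have [t ht] := onthW lt.
move=> [-> Eu]; exists tt; constructor 2; exists t; split=> //.
by apply/IH => //; exists s, m; split=> //; lia.
Qed.

Lemma final_nfaP w :
  accepts (final_nfa W) w <->
  exists s r, [/\ w = map lett W ++ rcons s r, ok \notin s & bad r].
Proof.
rewrite accepts_staged.
have fin i u : staged_accepts U_start U_end U_rule true W i true u ->
    i = D /\ u = [::].
  by case: u => [|a u] /= [] // q' [[]|[t []]|[]].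
suff gen i : i <= D ->
  staged_accepts U_start U_end U_rule true W i false w <->
  exists s r, [/\ w = map lett (drop i W) ++ rcons s r, ok \notin s & bad r].
  by rewrite gen // drop0.
elim: w i => [|a w IH] i iD /=.
  split=> [[]//|[s [r []]]].
  by case: drop => //; case: s.
split.
  move=> [q' [[]//|[t [ht /and3P[_ /negbTE q'F /eqP->]]]|[iE]]].
    rewrite q'F => /IH[]; first exact: onth_size_lt ht.
    move=> s [r [-> h1 h2]]; exists s, r; split=> //.
    rewrite [drop i W](drop_nth t) ?(onth_size_lt ht) //=.
    by rewrite (@onth_nth _ t _ _ _ ht).
  rewrite /U_end /=; case: q' => h.
    by move=> /fin[_ ->]; exists [::], a; rewrite iE drop_size.
  move=> /IH[]// s [r []]; rewrite iE drop_size /= => -> h1 h2.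
  by exists (a :: s), r; rewrite inE eq_sym negb_or h h1.
move=> [s [r []]]; move: iD; rewrite leq_eqVlt => /orP[/eqP iE|lt].
  rewrite iE /D drop_size /=; case: s => [|b s] /= [-> Ew].
    by move=> _ h; exists true; constructor 3; rewrite Ew.
  rewrite inE negb_or eq_sym => /andP[h1 h2] h3.
  exists false; constructor 3; split=> //; apply/IH => //.
  by exists s, r; rewrite drop_size.
have [t ht] := onthW lt; rewrite (drop_nth t) //= (@onth_nth _ t _ _ _ ht).
move=> -[-> Ew] h1 h2.
exists false; constructor 2; exists t; split; rewrite /U_rule ?eqxx //.
by apply/IH => //; exists s, r.
Qed.

(** By [3 <= D] the whole window is read before the last stage. *)
Lemma step_nfaP z :
  3 <= D ->
  accepts (step_nfa W) z <->
  exists s1 a b c s2 e s3, [/\ chk a b c e, size s2 + 3 = D &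
    z = zip (s1 ++ [:: a, b, c & s2 ++ ok :: s3])
            (s1 ++ [:: a, b, c & s2 ++ e :: s3])].
Proof.
move=> D3; rewrite accepts_staged.
pose acc := staged_accepts T_start T_end (fun=> T_rule) (inl (inl (inl true))) W.
(* The phases of a run are described from last to first: copying after the replaced letter, waiting
   for it, and two, one or no letters of the window read. *)
have fin u : acc D (inl (inl (inl true))) u <-> exists s, u = zip s s.
  elim: u => [|[a b] u IH] /=; first by split=> // _; exists [::].
  split=> [[q' [[]|[t []]|[_]]]|[[|c s] //= [-> -> Eu]]].
  - by move=> D0; move: D3; rewrite D0.
  - by move=> ht; have := onth_size_lt ht; rewrite ltnn.
  - case: q' => [[[[]|]|]|] //= /eqP-> /IH[s ->].
    by exists (b :: s).
  exists (inl (inl (inl true))); constructor 3; split=> //=.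
  by apply/IH; exists s.
have wait e i u : 0 < i <= D -> acc i (inr e) u <-> exists s2 s3,
    size s2 = D - i /\ u = zip (s2 ++ ok :: s3) (s2 ++ e :: s3).
  elim: u i => [|[a b] u IH] i /andP[i0 iD] /=.
    by split=> [[]//|[[|x s] [s3 []]]].
  split.
    move=> [q' [[]|[t [ht]]|[iE]]].
    - by move=> i0'; rewrite i0' in i0.
    - case: q' => //= e' /andP[/eqP-> /eqP->] /IH[].
        by rewrite /= (onth_size_lt ht).
      move=> s2 [s3 [sz ->]]; exists (b :: s2), s3; split=> //=.
      by rewrite sz; move: (onth_size_lt ht); rewrite -/D; lia.
    case: q' => [[[[]|]|]|] //= /eqP[-> ->]; rewrite iE => /fin[s ->].
    by exists [::], s; rewrite subnn.
  move=> [[|x s2] [s3 [/= sz]]] [-> -> Eu].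
    have iE : i = D by lia.
    exists (inl (inl (inl true))); constructor 3; split=> //=.
    by rewrite iE; apply/fin; exists s3.
  have lt : i < D by lia.
  have [t ht] := onthW lt.
  exists (inr e); constructor 2; exists t; split; rewrite /= ?eqxx //.
  by apply/IH; [rewrite /= lt|exists s2, s3; split=> //; lia].
have two a b u : acc 2 (inl (inr (a, b))) u <->
    exists c e u', [/\ chk a b c e, u = (c, c) :: u' & acc 3 (inr e) u'].
  case: u => [|[c c'] u] /=; first by split=> [[]//|[? [? [? []]]]].
  split.
    move=> [q' [[]//|[t [_]]|[D2]]]; last by move: D3; rewrite /D -D2.
    by case: q' => //= e /andP[/eqP-> h] ha; exists c', e, u.
  move=> [d [e [u' [h [-> -> ->] ha]]]].
  have [t ht] := onthW D3.
  by exists (inr e); constructor 2; exists t; split; rewrite //= eqxx.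
have one a u : acc 1 (inl (inl (inr a))) u <->
    exists b u', u = (b, b) :: u' /\ acc 2 (inl (inr (a, b))) u'.
  case: u => [|[c c'] u] /=; first by split=> [[]//|[? [? []]]].
  split.
    move=> [q' [[]//|[t [_]]|[D1]]]; last by move: D3; rewrite /D -D1.
    by case: q' => [[[]|[a' b]]|] //= /andP[/eqP-> /eqP[-> ->]] ha; exists b, u.
  move=> [b [u' [[-> -> ->] ha]]].
  have [t ht] := onthW (ltnW D3).
  by exists (inl (inr (a, b))); constructor 2; exists t; split; rewrite //= !eqxx.
have start u : acc 0 (inl (inl (inl false))) u <-> exists s1 a u',
    u = zip s1 s1 ++ (a, a) :: u' /\ acc 1 (inl (inl (inr a))) u'.
  elim: u => [|[c c'] u IH] /=.
    by split=> [[]//|[[|x s1] [? [? []]]]].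
  split.
    move=> [q' [[_]|[t [_]]|[D0]]]; last by move: D3; rewrite /D -D0.
      case: q' => [[[[]|]|]|] //= /eqP-> /IH[s1 [a [u' [-> ha]]]].
      by exists (c' :: s1), a, u'.
    case: q' => [[[|a]|]|] //=; try by case.
    by move=> /eqP[-> ->] ha; exists [::], a, u.
  move=> [[|x s1] [a [u' [[-> -> Eu] ha]]]].
    have [t ht] := onthW (ltnW (ltnW D3)).
    exists (inl (inl (inr a))); constructor 2; exists t.
    by split; rewrite //= ?eqxx // Eu.
  exists (inl (inl (inl false))); constructor 1; split=> //=.
  by apply/IH; exists s1, a, u'.
apply: iff_trans (start z) _; split.
  move=> [s1 [a [u1 [-> /one[b [u2 [->]]]]]]].
  move=> /two[c [e [u3 [h -> /wait[|s2 [s3 [sz ->]]]]]]].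
    by rewrite /= D3.
  exists s1, a, b, c, s2, e, s3; split=> //; first by rewrite sz subnK.
  by rewrite [RHS]zip_cat.
move=> [s1 [a [b [c [s2 [e [s3 [h sz ->]]]]]]]].
pose z' := zip (s2 ++ ok :: s3) (s2 ++ e :: s3).
rewrite zip_cat //; exists s1, a, [:: (b, b), (c, c) & z']; split=> //.
apply/one; exists b, ((c, c) :: z'); split=> //.
apply/two; exists c, e, z'; split=> //.
by apply/wait; [rewrite D3|exists s2, s3; split=> //; rewrite -sz addnK].
Qed.

(** * Consistent words and the relation [reach1] *)

Hypothesis D3 : 3 <= D.
Hypothesis chk_ok : forall a b c e, chk a b c e ->
  [/\ a != ok, b != ok, c != ok & e != ok].
Hypothesis lett_ok : forall t, lett t != ok.
Hypothesis bad_ok : forall a, bad a -> a != ok.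

Let R := RTS (init_nfa W) (step_nfa W).

Lemma stepP v w : rts_step R v w <->
  exists s1 a b c s2 e s3, [/\ chk a b c e, size s2 + 3 = D,
    v = s1 ++ [:: a, b, c & s2 ++ ok :: s3] &
    w = s1 ++ [:: a, b, c & s2 ++ e :: s3]].
Proof.
rewrite /rts_step step_nfaP //; split.
  move=> [sz [s1 [a [b [c [s2 [e [s3 [h1 h2 E]]]]]]]]].
  exists s1, a, b, c, s2, e, s3; split=> //.
    rewrite -[v](@unzip1_zip _ _ v w) ?sz // E unzip1_zip //.
    by rewrite !size_cat /= !size_cat.
  rewrite -[w](@unzip2_zip _ _ v w) ?sz // E unzip2_zip //.
  by rewrite !size_cat /= !size_cat.
move=> [s1 [a [b [c [s2 [e [s3 [h1 h2 -> ->]]]]]]]]; split.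
  by rewrite !size_cat /= !size_cat.
by exists s1, a, b, c, s2, e, s3.
Qed.

Definition consistent (w : seq S) : Prop :=
  forall p, p + D < size w ->
  chk (nth ok w p) (nth ok w p.+1) (nth ok w p.+2) (nth ok w (p + D)).

Lemma nth_hole (s1 s2 s3 : seq S) x y i :
  nth ok (s1 ++ s2 ++ x :: s3) i =
  if i == size s1 + size s2 then x else nth ok (s1 ++ s2 ++ y :: s3) i.
Proof.
rewrite !catA !nth_cat size_cat; case: ltngtP => // [gt|->]; last by rewrite subnn.
by case: (i - _) (subn_gt0 (size s1 + size s2) i) => // ; rewrite gt.
Qed.

(** With [ok] as default letter, the pointwise comparison also holds beyond the ends of the
    words. *)
Lemma step_nthP v w : rts_step R v w <-> size v = size w /\
  exists p, [/\ p + D < size w,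
    chk (nth ok w p) (nth ok w p.+1) (nth ok w p.+2) (nth ok w (p + D)) &
    forall i, nth ok v i = if i == p + D then ok else nth ok w i].
Proof.
rewrite stepP; split.
  move=> [s1 [a [b [c [s2 [e [s3 [h1 h2 -> ->]]]]]]]].
  split; first by rewrite !size_cat /= !size_cat.
  have h3 : size [:: a, b, c & s2] = D by rewrite -h2 /= addn3.
  have hole x y i := nth_hole s1 [:: a, b, c & s2] s3 x y i.
  rewrite h3 in hole; exists (size s1); split.
  - by rewrite size_cat ltn_add2l /= size_cat /= -h2; lia.
  - rewrite [nth ok _ (size s1 + D)](hole e ok) eqxx.
    rewrite !nth_cat ltnn subnn /= !ltnNge -addn1 -(addn1 (_ + _)) -addnA.
    by rewrite !leq_addr /= !addKn.
  by move=> i; apply: hole.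
move=> [sz [p [lt h hv]]].
exists (take p w), (nth ok w p), (nth ok w p.+1), (nth ok w p.+2).
(* The letters between the window and the replaced letter. *)
pose s2 := take (D - 3) (drop p.+3 w).
have sz2 : size s2 + 3 = D by rewrite size_takel ?size_drop; lia.
exists s2, (nth ok w (p + D)), (drop (p + D).+1 w).
have Ew : w = take p w ++ [:: nth ok w p, nth ok w p.+1, nth ok w p.+2 &
    s2 ++ nth ok w (p + D) :: drop (p + D).+1 w].
  rewrite -{1}(cat_take_drop p w); congr (_ ++ _).
  have [l1 l2 l3] : [/\ p < size w, p.+1 < size w & p.+2 < size w] by split; lia.
  rewrite (drop_nth ok l1) (drop_nth ok l2) (drop_nth ok l3); do 3!congr (_ :: _).
  rewrite -{1}(cat_take_drop (D - 3) (drop p.+3 w)) drop_drop.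
  congr (_ ++ _); have -> : D - 3 + p.+3 = p + D by lia.
  exact: drop_nth.
split=> //; apply: (@eq_from_nth _ ok) => [|i _].
  by rewrite sz {1}Ew !size_cat /= !size_cat.
have szp : size (take p w) = p by rewrite size_takel //; lia.
have h3 x : size [:: nth ok w p, nth ok w p.+1, x & s2] = D by rewrite /= -sz2 addn3.
have := nth_hole (take p w) [:: nth ok w p, nth ok w p.+1, nth ok w p.+2 & s2]
  (drop (p + D).+1 w) ok (nth ok w (p + D)) i.
by rewrite h3 szp !cat_cons -Ew hv => ->.
Qed.

Lemma consistent_reach u w : consistent w ->
  take D w = take D u -> size u = size w -> (forall i, D <= i -> nth ok u i = ok) ->
  ok \notin w -> reach1 R u w.
Proof.
move=> cw Eu sz uok wok l phi ind.
(* The configurations of a genuine run from [u] to [w], along which every inductive formula is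
   preserved. *)
pose v m := take m w ++ nseq (size w - m) ok.
have szv m : size (v m) = size w.
  by rewrite size_cat size_nseq size_take_min; lia.
have nthv m i : nth ok (v m) i = if i < m then nth ok w i else ok.
  rewrite nth_cat size_take_min nth_nseq if_same.
  case: (ltnP i (minn m (size w))) => [lt|ge].
    by have im : i < m; [lia|rewrite nth_take // im].
  by case: ltnP => // lt; rewrite nth_default //; lia.
(* The step restores position [m]; its window starts at [m - D] and lies in the part already
   restored, since [3 <= D]. *)
have stp m : D <= m < size w -> rts_step R (v m) (v m.+1).
  move=> /andP[Dm lt]; apply/step_nthP; rewrite !szv; split=> //.
  exists (m - D); rewrite subnK //; split=> //.
    rewrite !nthv !ifT; try lia.
    by have := cw (m - D); rewrite subnK //; apply.
  by move=> i; rewrite !nthv ltnS; case: (ltngtP i m).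
(* The words may be shorter than [D]; then [u = w] and the run is empty. *)
have Ev : u = v (minn D (size w)).
  apply: (@eq_from_nth _ ok) => [|i lt]; first by rewrite szv.
  rewrite nthv; case: ltnP => h; last by apply: uok; rewrite sz in lt; lia.
  have iD : i < D by lia.
  by rewrite -[RHS](nth_take ok iD) Eu nth_take.
have sat_v m : minn D (size w) <= m <= size w -> sat u phi -> sat (v m) phi.
  elim: m => [|m IH].
    by rewrite leqn0 => /andP[/eqP h _]; rewrite Ev h.
  move=> /andP[]; rewrite leq_eqVlt => /orP[/eqP h|h1 h2]; first by rewrite -h -Ev.
  move=> hu; apply: ind (stp m _); first by apply: IH => //; lia.
  by lia.
have -> : w = v (size w) by rewrite /v take_size subnn cats0.
by apply: sat_v; rewrite geq_minr leqnn.
Qed.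

Lemma reach_consistent u w : accepts (init_nfa W) u -> reach1 R u w ->
  ok \notin w -> consistent w.
Proof.
move=> /init_nfaP[s [m [szs Eu]]] ruw wok p lt; apply/negPn/negP => nchk.
have lt_ok i : i < size w -> nth ok w i != ok.
  by move=> il; apply: contraNneq wok => <-; apply: mem_nth.
(* The clause [c] below excludes exactly the words of length [size w] with all letters in the box.
   Only at [p + D] does the box omit [ok]. *)
pose mem_box q i := (q == nth ok w i) || (i != p + D) && (q == ok).
pose c : seq (literal S (size w)) :=
  [seq Atom x.1 x.2 | x <- enum [pred x : S * 'I_(size w) | ~~ mem_box x.1 x.2]].
have cP v : has (sat_literal v) c <->
    exists i : 'I_(size w), i < size v /\ ~~ mem_box (nth ok v i) i.
  rewrite /c has_map; split=> [/hasP[[q i]]|[i [iv h]]].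
    rewrite mem_enum inE /= => h /eqP E; exists i.
    by rewrite (@onth_nth _ ok _ _ _ E) -onthTE E.
  apply/hasP; exists (nth ok v i, i); first by rewrite mem_enum.
  by rewrite /= onthE (nth_map ok).
(* Steps preserve length, so the empty clause for length [size w] is inductive; it fails at [w],
   hence also at [u]. *)
have szw : size u = size w.
  pose no : formula1 S (size w) := Clause [::].
  have ind : inductive_formula R no.
    by move=> x y; rewrite /sat /= !implybF => h [E _]; rewrite -E.
  have := ruw _ no ind; rewrite /sat /= eqxx implyTb implybF.
  by case: eqP => // _ /(_ erefl).
have ind : inductive_formula R (Clause c).
  move=> v v' sv /step_nthP[szv [p' [lt' chk' hv]]].
  apply/implyP => /eqP szv'; rewrite szv' in lt'.
  move: sv; rewrite /sat szv szv' eqxx /= => /cP[i [iv nb]].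
  apply: contraT => ncl; case/negP: nb.
  have box j : j < size w -> mem_box (nth ok v' j) j.
    move=> jw; apply: contraR ncl => nb; apply/cP.
    by exists (Ordinal jw); rewrite szv'.
  move: (ltn_ord i) (box i (ltn_ord i)); rewrite hv; case: eqP => // -> lt2 _.
  (* A step into the box must remove a letter [ok] that the box forbids, which is possible only at
     [p + D]. *)
  rewrite /mem_box eqxx andbT; apply/orP; right; apply/eqP => E.
  have pp : p' = p by apply: (@addIn D).
  case/negP: nchk; have [o1 o2 o3 o4] := chk_ok chk'.
  (* Letters of the box other than [ok] are those of [w], so the rule, which held for this step,
     would hold in [w] at [p]. *)
  have eqw j : j < size w -> nth ok v' j != ok -> nth ok v' j = nth ok w j.
    by move=> jw nk; have := box j jw; rewrite /mem_box (negbTE nk) andbF orbF => /eqP.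
  by rewrite -!eqw -?pp //; lia.
(* An initial configuration has [ok] at [p + D], outside the box. *)
have : sat u (Clause c).
  apply/implyP => _; apply/cP.
  exists (Ordinal lt) => /=; rewrite szw; split=> //.
  have -> : nth ok u (p + D) = ok.
    by rewrite Eu nth_cat szs ltnNge leq_addl /= nth_nseq if_same.
  by rewrite /mem_box !eqxx orbF eq_sym lt_ok.
move=> /(ruw _ _ ind); rewrite /sat eqxx /= => /cP[i [_]].
by rewrite /mem_box eqxx.
Qed.

Lemma reachable_iff_consistent :
  (exists w, IndInv1 R w /\ accepts (final_nfa W) w) <->
  exists s r, [/\ consistent (map lett W ++ rcons s r), ok \notin s & bad r].
Proof.
have nok s r : ok \notin s -> bad r -> ok \notin map lett W ++ rcons s r.
  move=> hs hr; rewrite mem_cat mem_rcons inE !negb_or hs eq_sym bad_ok // andbT.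
  by elim: (W) => //= t V IH; rewrite inE negb_or eq_sym lett_ok.
split.
  move=> [w [[u iu ruw] /final_nfaP[s [r [Ew hs hr]]]]].
  exists s, r; split=> //; rewrite -Ew; apply: reach_consistent iu ruw _.
  by rewrite Ew; apply: nok.
move=> [s [r [cw hs hr]]]; exists (map lett W ++ rcons s r); split; last first.
  by apply/final_nfaP; exists s, r.
exists (map lett W ++ nseq (size s).+1 ok).
  by apply/init_nfaP; exists (map lett W), (size s).+1; rewrite size_map.
have szl : size (map lett W) = D by rewrite size_map.
apply: consistent_reach => //; last exact: nok.
- by rewrite -!szl !take_size_cat.
- by rewrite !size_cat size_nseq size_rcons.
by move=> i Di; rewrite nth_cat nth_nseq if_same szl ltnNge Di.
Qed.

End Checking.

(** * Space-time diagrams of Turing machines *)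

Section SpaceTime.

Variable M : tm 0.

Notation state := (tm_state M).
Notation sym := (symbol (tm_aux M)).

(* A tape symbol with, on the scanned cell, the state; [Some None] is an extra
   state that moves one cell to the right and starts [M]. *)
Definition cell : finType :=
  (option (bool + tm_aux M) * option (option state))%type.

Definition blank_cell : cell := (None, None).

(** A halted machine idles in place, in agreement with [tm_step]. *)
Definition next (q : option state) (s : sym) : state * sym * move :=
  if q is Some p then
    if tm_verdict p is Some _ then (p, s, Stay) else
    let: (p', a) := tm_delta p [ffun=> s] in (p', (a ord0).1, (a ord0).2)
  else (tm_start M, s, MoveRight).

(** The state that a head on [c] sends in direction [m], if any. *)
Definition arrives (m : move) (c : cell) : option (option state) :=
  if c.2 is Some q then
    let: (p, _, m') := next q c.1 in
    match m, m' with
    | MoveLeft, MoveLeft | Stay, Stay | MoveRight, MoveRight => Some (Some p)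
    | _, _ => None
    end
  else None.

Definition succ_cell (l c r : cell) : cell :=
  if c.2 is Some q then ((next q c.1).1.2, arrives Stay c)
  else (c.1, if arrives MoveRight l is Some s then Some s else arrives MoveLeft r).

Definition content (t : tape sym) (h j : nat) : sym :=
  if j == h then thead t else if j < h then nth None (tleft t) (h - j.+1)
  else nth None (tright t) (j - h.+1).

Definition row (q : option state) (t : tape sym) (h j : nat) : cell :=
  (content t h j, if j == h then Some q else None).

Definition shift_head (m : move) (h : nat) : nat :=
  match m with MoveLeft => h.-1 | Stay => h | MoveRight => h.+1 end.

(** By [0 < h] the predecessor in [shift_head] is not truncated, and a move of the head merely
    reindexes the columns. *)
Lemma content_act s m t h j :
  0 < h -> content (tape_move None m (tape_write s t)) (shift_head m h) j =
  if j == h then s else content t h j.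
Proof.
case: h => // h _; case: t => l a r; rewrite /content; case: m => /=.
- rewrite nth_behead; case: (ltngtP j h) => [lt|gt|->].
  + have [-> ->] : (j == h.+1) = false /\ j < h.+1 by lia.
    by rewrite subSS subnSK.
  + case: (ltngtP j h.+1) => [|gt'|->]; [by lia| |by rewrite subnn].
    by rewrite -(subnSK gt').
  + by rewrite ltnSn ltn_eqF // subnn; case: l.
- by case: eqP.
rewrite nth_behead; case: (ltngtP j h.+2) => [lt|gt|->].
- case: (ltngtP j h.+1) => [lt'|gt'|->]; [|by lia|by rewrite subnn].
  by rewrite subSn.
- have [-> ->] : (j == h.+1) = false /\ (j < h.+1) = false by lia.
  by rewrite subnSK.
by rewrite gtn_eqF // ltnNge leqnSn /= subnn; case: r.
Qed.

(** The neighbours enter only through the states they send, because at the ends of a row the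
    adjacent letters of the word belong to other rows. *)
Lemma row_succ q t h j l r p s m :
  0 < h -> next q (thead t) = (p, s, m) ->
  arrives MoveRight l = (if j == h.+1 then arrives MoveRight (row q t h h) else None) ->
  arrives MoveLeft r = (if j.+1 == h then arrives MoveLeft (row q t h h) else None) ->
  succ_cell l (row q t h j) r =
  row (Some p) (tape_move None m (tape_write s t)) (shift_head m h) j.
Proof.
move=> h0 E El Er; rewrite [RHS]/row content_act // /succ_cell.
rewrite El Er /arrives /= eqxx /content eqxx E /=.
case: (eqVneq j h) => [->|jh] /=.
  by rewrite E; case: m {E} => /=; congr (_, _); case: eqP => //; lia.
congr (_, _); case: m {E} => /=.
- rewrite if_same; case: eqP => h1; case: eqP => h2 //; lia.
- by rewrite !if_same (negbTE jh).
- by rewrite if_same; case: eqP.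
Qed.

(** * Letters as ordinals, and the local rule on them *)

Definition alphabet : finType := 'I_#|{: option cell}|.

Definition ok : alphabet := enum_rank None.
Definition letter_of (c : cell) : alphabet := enum_rank (Some c).

Definition check (a b c e : alphabet) : bool :=
  match enum_val a, enum_val b, enum_val c with
  | Some l, Some m, Some r => enum_val e == Some (succ_cell l m r)
  | _, _, _ => false
  end.

Definition rejecting (a : alphabet) : bool :=
  if enum_val a is Some (_, Some (Some q)) then tm_verdict q == Some false
  else false.

Lemma letter_of_ok c : letter_of c != ok.
Proof. by apply/eqP => /enum_rank_inj. Qed.

Lemma alphabetP a : a != ok -> exists c, a = letter_of c.
Proof.
rewrite -[a]enum_valK /ok; case: (enum_val a) => [c|]; last by rewrite eqxx.
by exists c.
Qed.

Lemma check_letters l m r e :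
  check (letter_of l) (letter_of m) (letter_of r) (letter_of e) =
  (e == succ_cell l m r).
Proof. by rewrite /check !enum_rankK (inj_eq Some_inj). Qed.

Lemma check_ok a b c e : check a b c e -> [/\ a != ok, b != ok, c != ok & e != ok].
Proof.
have nok d : d != ok = (enum_val d != None) :> bool.
  by rewrite -(inj_eq enum_val_inj) enum_rankK.
rewrite !nok /check; case: enum_val => // l; case: enum_val => // m.
by case: enum_val => // r /eqP->.
Qed.

Lemma rejecting_ok a : rejecting a -> a != ok.
Proof. by apply: contraTneq => ->; rewrite /rejecting enum_rankK. Qed.

Lemma rejecting_letter c : rejecting (letter_of c) =
  if c.2 is Some (Some q) then tm_verdict q == Some false else false.
Proof. by rewrite /rejecting enum_rankK; case: c. Qed.

(** * The diagram of the run on a fixed input *)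

Variables (x : seq bool) (s o : nat).
(** The mark [inr true] puts the extra state on the blank before the input. No input letter then
    carries a state, so [x] is copied verbatim and the empty input is no exception. *)
Definition init_word : seq letter :=
  nseq o (inr false) ++ inr true :: map inl x ++ nseq o (inr false).

Definition cell_of (a : letter) : cell :=
  match a with
  | inl b => (Some (inl b), None)
  | inr false => blank_cell
  | inr true => (None, Some None)
  end.

(* One row of the diagram is one letter shorter than the initial word, so that
   the window of a cell starts [size init_word] letters before it. *)
Definition period : nat := 2 * o + size x.

Lemma size_init_word : size init_word = period.+1.
Proof. by rewrite size_cat /= size_cat size_map !size_nseq /period; lia. Qed.

Hypothesis space : forall i, size (tape_cells (ctapes (tm_run M x i) ord0)) <= s.
Hypothesis so : s.+1 < o.

Definition st i : state := cstate (tm_run M x i).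
Definition tp i : tape sym := ctapes (tm_run M x i) ord0.

Fixpoint pos (i : nat) : nat :=
  if i is i'.+1 then shift_head (next (Some (st i')) (thead (tp i'))).2 (pos i')
  else o.+1.

Lemma tm_run_succ i p a m : next (Some (st i)) (thead (tp i)) = (p, a, m) ->
  st i.+1 = p /\ tp i.+1 = tape_move None m (tape_write a (tp i)).
Proof.
rewrite /st /tp /tm_run iterS; set c := iter _ _ _ => /=.
rewrite /tm_step; case: tm_verdict => [b|].
  by move=> [<- <- <-]; case: (ctapes c ord0).
have -> : [ffun i => thead (ctapes c i)] = [ffun=> thead (ctapes c ord0)].
  by apply/ffunP=> j; rewrite !ffunE (ord1 j).
by case: tm_delta => q act [<- <- <-]; rewrite /= ffunE.
Qed.

Lemma pos_succ i p a m : next (Some (st i)) (thead (tp i)) = (p, a, m) ->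
  pos i.+1 = shift_head m (pos i).
Proof.
move=> E.
by have -> : m = (next (Some (st i)) (thead (tp i))).2 by rewrite E.
Qed.

Lemma pos_bound i : 2 <= pos i <= o + s.
Proof.
have sz j : size (tleft (tp j)) < size (tape_cells (tp j)).
  by rewrite size_cat size_rev /=; lia.
(* The number [e] counts the cells recorded to the left of the starting cell, so the leftmost
   recorded cell is in column [o.+1 - e]. *)
suff [e [e1 e2 e3]] : exists e, [/\ pos i + e = o.+1 + size (tleft (tp i)),
    e < size (tape_cells (tp i)) & 0 < pos i].
  have := space i; have := sz i; rewrite -/(tp i); lia.
elim: i => [|i [e [e1 e2 e3]]].
  exists 0; rewrite /tp /tm_run /= ffunE /= !addn0; split=> //.
case E : (next (Some (st i)) (thead (tp i))) => [[p a] m].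
have [_ ->] := tm_run_succ E; rewrite (pos_succ E).
have := space i; have := sz i; rewrite -/(tp i) => h1 h2.
case: (tp i) e1 e2 h1 h2 => l b r; rewrite /tape_cells size_cat size_rev /=.
case: m {E} => /=; rewrite ?size_cat ?size_rev /= => e1 e2 h1 h2.
- case: l e1 e2 h1 h2 => [|b' l] /= e1 e2 h1 h2; first by exists e.+1; split; lia.
  by exists e; split; lia.
- by exists e; split.
by exists e; rewrite size_behead; split; lia.
Qed.

(** Row [0] is for the extra state, hence row [i.+1] is the configuration at time [i]. *)
Definition diagram (i : nat) : nat -> cell :=
  if i is i'.+1 then row (Some (st i')) (tp i') (pos i')
  else row None (Tape [::] None (bits _ x)) o.

Definition dpos (i : nat) : nat := if i is i'.+1 then pos i' else o.

Lemma dpos_bound i : 2 <= s -> 2 <= dpos i <= o + s.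
Proof. by case: i => [|i] s2; [rewrite /=; lia | apply: pos_bound]. Qed.

Lemma diagram_head i j : j != dpos i -> (diagram i j).2 = None.
Proof. by case: i => [|i] /= /negbTE->. Qed.

Lemma diagram_succ i j l r :
  arrives MoveRight l =
    (if j == (dpos i).+1 then arrives MoveRight (diagram i (dpos i)) else None) ->
  arrives MoveLeft r =
    (if j.+1 == dpos i then arrives MoveLeft (diagram i (dpos i)) else None) ->
  succ_cell l (diagram i j) r = diagram i.+1 j.
Proof.
case: i => [|i] El Er.
  have E : next None (thead (Tape [::] None (bits (tm_aux M) x))) =
           (tm_start M, None, MoveRight) by [].
  rewrite (row_succ (leq_ltn_trans (leq0n _) so) E El Er).
  rewrite /= /row /st /tp /tm_run /= ffunE eqxx; congr (_, _).
  rewrite /content /=; case: eqP => // _; case: ltnP => // _.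
  by case: (_ - _) => [|?]; rewrite /= ?nth_nil.
case E : (next (Some (st i)) (thead (tp i))) => [[p a] m].
rewrite [RHS]/diagram (pos_succ E); have [-> ->] := tm_run_succ E.
by apply: row_succ E El Er; have /andP[/ltnW] := pos_bound i.
Qed.

Definition trace (p : nat) : cell := diagram (p %/ period) (p %% period).

Hypothesis s2 : 2 <= s.

Lemma traceE i j : j < period -> trace (i * period + j) = diagram i j.
Proof.
move=> lt; rewrite /trace divnMDl ?modnMDl ?(divn_small lt) ?(modn_small lt) ?addn0 //.
by apply: leq_ltn_trans lt.
Qed.

Lemma arrives_none m c : c.2 = None -> arrives m c = None.
Proof. by rewrite /arrives => ->. Qed.

Lemma arrives_diagram m i j : arrives m (diagram i j) =
  if j == dpos i then arrives m (diagram i (dpos i)) else None.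
Proof.
by case: (eqVneq j (dpos i)) => [->//|/(@diagram_head i)/arrives_none->].
Qed.

(** The middle letter of the window lies directly above the new cell, one [period] earlier. Inside a
    row the rule is [diagram_succ]; at the ends the padding ensures that no head is near. *)
Lemma trace_succ p : trace (p + period.+1) =
  succ_cell (trace p) (trace p.+1) (trace p.+2).
Proof.
have P1 : 4 <= period by rewrite /period; lia.
have bnd i := dpos_bound i s2.
have [i [j [Ep lt]]] : exists i j, p.+1 = i * period + j /\ j < period.
  exists (p.+1 %/ period), (p.+1 %% period); split; first exact: divn_eq.
  by rewrite ltn_mod; lia.
have -> : p + period.+1 = i.+1 * period + j by rewrite mulSn; lia.
rewrite Ep !traceE //; apply/esym/diagram_succ.
  case: j Ep lt => [|j] Ep lt.
    (* In column [0] the left letter of the window is the last cell of the preceding row, where no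
       head stands. *)
    case: i Ep => [|i] Ep; first by rewrite mul0n in Ep.
    have -> : p = i * period + period.-1 by move: Ep; rewrite mulSn; lia.
    rewrite traceE; last by lia.
    rewrite arrives_diagram ifF //.
    by have := bnd i; rewrite /period; move: (dpos i) => h; lia.
  have -> : p = i * period + j by lia.
  by rewrite traceE ?(ltnW lt) // arrives_diagram eqSS.
rewrite -addnS.
have [lt'|ge] := ltnP j.+1 period; first by rewrite traceE // arrives_diagram.
(* In the last column the right letter is column [0] of the next row, again without a head. *)
have jE : j.+1 = period by lia.
have -> : i * period + j.+1 = i.+1 * period + 0 by rewrite mulSn; lia.
rewrite traceE; last by lia.
rewrite arrives_diagram !ifF //.
  by have := bnd i; rewrite jE /period; move: (dpos i) => h; lia.
by have := bnd i.+1; move: (dpos i.+1) => h; lia.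
Qed.

Lemma trace_init p : p < period.+1 ->
  trace p = nth blank_cell (map cell_of init_word) p.
Proof.
have P1 : 4 <= period by rewrite /period; lia.
(* The last letter of the initial word is already column [0] of row [1], a blank cell. *)
rewrite ltnS leq_eqVlt => /orP[/eqP->|lt].
  rewrite -[X in trace X]addn0 -[X in trace (X + _)]mul1n traceE; last by lia.
  rewrite map_cat /= map_cat !map_nseq nth_cat size_nseq ifF;
    last by rewrite /period; lia.
  have -> : period - o = (o + size x).-1.+1 by rewrite /period; lia.
  rewrite /= nth_cat !size_map ifF; last by lia.
  rewrite nth_nseq if_same /row /content /=.
  by rewrite /tp /tm_run /= ffunE eqxx /= nth_nil.
rewrite -[p]add0n -[X in trace (X + _)](mul0n period) traceE // /= /row /content.
rewrite map_cat /= map_cat !map_nseq nth_cat size_nseq /=.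
case: (ltngtP p o) => [lt'|gt|->]; last by rewrite subnn.
  by rewrite nth_nil nth_nseq if_same.
rewrite -(subnSK gt) /= -map_comp nth_cat size_map.
case: ltnP => lt2; first by rewrite !(nth_map false).
by rewrite nth_nseq if_same nth_default // size_map.
Qed.

(** * The reduced instance *)

Definition word_letter (a : letter) : alphabet := letter_of (cell_of a).

Definition reduced : instance :=
  @Instance #|{: option cell}|
    (RTS (init_nfa ok init_word) (step_nfa ok check init_word))
    (final_nfa ok word_letter rejecting init_word).

Lemma period_ge : 2 <= period.
Proof. by rewrite /period; lia. Qed.

Lemma trace_word p : p < size init_word ->
  nth ok (map word_letter init_word) p = letter_of (trace p).
Proof.
by move=> lt; rewrite trace_init -?size_init_word // !(nth_map (inr false)).
Qed.

(** Strong induction: beyond the initial word, the rule determines each letter from three earlier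
    ones. *)
Lemma consistent_trace w :
  take (size init_word) w = map word_letter init_word ->
  consistent ok check init_word w ->
  forall p, p < size w -> nth ok w p = letter_of (trace p).
Proof.
move=> Ew cw; elim/ltn_ind => p IH pw.
have [lt|ge] := ltnP p (size init_word).
  by rewrite -trace_word // -Ew nth_take.
have P2 := period_ge; rewrite size_init_word in ge.
have := cw (p - size init_word); rewrite size_init_word subnK // => /(_ pw) h.
have [_ _ _ /alphabetP[e Ee]] := check_ok h; move: h.
rewrite Ee (IH (p - period.+1)) ?(IH (p - period.+1).+1) ?(IH (p - period.+1).+2);
  try lia.
by rewrite check_letters -trace_succ subnK // => /eqP->.
Qed.

Lemma reducedP :
  IndInv1_disjoint reduced <-> ~ exists i, tm_verdict (st i) = Some false.
Proof.
have D3 : 2 < size init_word by rewrite size_init_word ltnS period_ge.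
have key : (exists i, tm_verdict (st i) = Some false) <->
    exists w, IndInv1 (system reduced) w /\ accepts (automaton reduced) w.
  apply: iff_sym; apply: iff_trans; first apply: reachable_iff_consistent => //.
  - exact: check_ok.
  - by move=> a; apply: letter_of_ok.
  - exact: rejecting_ok.
  have szW : size (map word_letter init_word) = size init_word by rewrite size_map.
  split.
    move=> [v [r [cv _ rr]]].
    have := consistent_trace _ cv; rewrite -{1}szW take_size_cat // => /(_ erefl).
    move=> /(_ (size init_word + size v)).
    rewrite [size (_ ++ rcons _ _)]size_cat szW size_rcons ltn_add2l ltnSn => /(_ isT).
    rewrite nth_cat szW ltnNge leq_addr /= addKn nth_rcons ltnn eqxx => Er.
    move: rr; rewrite Er rejecting_letter /trace; set i := _ %/ _; set j := _ %% _.
    (* Row [0] carries only the extra state, which has no verdict. *)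
    case: i => [|i] /=; first by case: eqP.
    by case: eqP => // _ /eqP h; exists i.
  (* The word is the trace cut at the head of the rejecting configuration. *)
  move=> [i hi]; pose p := i.+1 * period + pos i.
  have lt : pos i < period by have := pos_bound i; rewrite /period; lia.
  have pD : size init_word <= p.
    by have := pos_bound i; rewrite size_init_word /p mulSn; lia.
  exists [seq letter_of (trace j) | j <- iota (size init_word) (p - size init_word)].
  exists (letter_of (trace p)); split.
  - set w := _ ++ _.
    have Ew : w = [seq letter_of (trace j) | j <- iota 0 p.+1].
      rewrite /w -cats1 catA.
      have -> : map word_letter init_word =
          [seq letter_of (trace j) | j <- iota 0 (size init_word)].
        apply: (@eq_from_nth _ ok) => [|j]; first by rewrite !size_map size_iota.
        rewrite size_map => jl; rewrite trace_word // (nth_map 0) ?size_iota //.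
        by rewrite nth_iota.
      rewrite -map_cat -[X in iota X (_ - _)]add0n -iotaD subnKC //.
      by rewrite -addn1 iotaD map_cat.
    have szw : size w = p.+1 by rewrite Ew size_map size_iota.
    have nw j : j < p.+1 -> nth ok w j = letter_of (trace j).
      by move=> jp; rewrite Ew (nth_map 0) ?size_iota // nth_iota.
    move=> j; rewrite szw => jl; have P2 := period_ge.
    rewrite !nw //; try (move: jl; rewrite size_init_word; lia).
    by rewrite check_letters size_init_word trace_succ.
  - by apply/mapP => -[j _ /esym/eqP]; rewrite (negbTE (letter_of_ok _)).
  rewrite rejecting_letter /p traceE // /diagram /row /= eqxx.
  by rewrite hi.
split=> [d /key[w h]|nh w h]; first exact: d w h.
by apply/nh/key; exists w.
Qed.

End SpaceTime.

(** * Programs that print automata *)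

(** Without the end mark, encodings of lists concatenate and can be printed piece by piece. *)
Definition enc_items (A : Type) (ea : A -> seq bool) (s : seq A) : seq bool :=
  flatten [seq true :: ea a | a <- s].

Lemma enc_seq_items (A : Type) (ea : A -> seq bool) s :
  enc_seq ea s = enc_items ea s ++ [:: false].
Proof. by elim: s => //= a s ->; rewrite /enc_items /= catA. Qed.

Lemma enc_items_cat (A : Type) (ea : A -> seq bool) s s' :
  enc_items ea (s ++ s') = enc_items ea s ++ enc_items ea s'.
Proof. by rewrite /enc_items map_cat flatten_cat. Qed.

Lemma enc_natD m n : enc_nat (m + n) = nseq m true ++ enc_nat n.
Proof. by rewrite /enc_nat nseqD rcons_cat. Qed.

(** States are plain numbers here, as their range depends on [W]. *)
Definition enc_rule (A : Type) (ea : A -> seq bool) : nat * A * nat -> seq bool :=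
  enc_pair (enc_pair enc_nat ea) enc_nat.

(** All state numbers respect the bound, so [inord] disappears from the encoding. *)
Lemma enc_staged (A Q : finType) (T : Type) (R0 RE : Q -> A -> Q -> bool) RD
    (q0 qf : Q) (ea : A -> seq bool) (W : seq T) :
  enc_nfa ea (staged R0 RE RD q0 qf W) =
  enc_nat (width Q * size W + #|Q|).+1 ++
  (true :: enc_nat (enum_rank q0) ++ [:: false]) ++
  (true :: enc_nat (width Q * size W + enum_rank qf) ++ [:: false]) ++
  enc_items (enc_rule ea) (map (shift 0 0) (rules R0) ++ chain RE RD 0 W) ++
  [:: false].
Proof.
have b0 (q : Q) : enum_rank q < (width Q * size W + #|Q|).+1.
  by rewrite ltnS ltnW // ltn_addl.
rewrite /enc_nfa /= /enc_ord inordK // inordK ?code_bound //.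
rewrite /= -?catA /= -?catA /=.
congr (_ :: (_ ++ _ :: (_ ++ _ :: _ :: (_ ++ _ :: _)))).
rewrite enc_seq_items; congr (_ ++ _).
rewrite /enc_items -[in LHS]map_comp; congr flatten.
apply/eq_in_map => r hr /=; congr cons.
rewrite /enc_rule /enc_pair /= /enc_ord.
suff [h1 h2] : r.1.1 < (width Q * size W + #|Q|).+1 /\
               r.2 < (width Q * size W + #|Q|).+1 by rewrite !inordK.
have cb := @code_bound Q T W.
move: hr; rewrite mem_cat => /orP[/mem_shift|/mem_chain[]].
- by move=> [q [a [q' [_ ->]]]]; rewrite /= !add0n !b0.
- move=> [i [t [q [a [q' [ht _ ->]]]]]] /=.
  have lt := onth_size_lt ht.
  by rewrite add0n addnA -mulnSr !cb // ltnW.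
by move=> [q [a [q' [_ ->]]]] /=; rewrite !add0n !cb.
Qed.

Section Programs.

Variable k : nat.
Implicit Types (st : store k) (r i t : 'I_k.+1).

Lemma app_app st r s s' : app (app st r s) r s' = app st r (s ++ s').
Proof. by apply/ffunP=> i; rewrite !ffunE; case: eqP; rewrite ?catA. Qed.

Lemma app_nil st r : app st r [::] = st.
Proof. by apply/ffunP=> i; rewrite ffunE; case: eqP; rewrite ?cats0. Qed.

Lemma appC st r r' s s' : r != r' ->
  app (app st r s) r' s' = app (app st r' s') r s.
Proof.
move=> rr; apply/ffunP=> i; rewrite !ffunE.
by case: eqP => // ->; rewrite eq_sym (negbTE rr).
Qed.

Lemma app_same st r s : app st r s r = st r ++ s.
Proof. by rewrite ffunE eqxx. Qed.

Lemma app_other st r s i : i != r -> app st r s i = st i.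
Proof. by rewrite ffunE => /negbTE->. Qed.

Definition seqs : seq (cmd k) -> cmd k := foldr (@Seq k) (@Skip k).

Definition emits r (s : seq letter) : cmd k := seqs [seq Emit r a | a <- s].

Lemma run_emits r s st : run (emits r s) st = app st r s.
Proof. by elim: s st => [|a s IH] st /=; rewrite ?app_nil // IH app_app. Qed.

Lemma run_seq c1 c2 st : run (Seq c1 c2) st = run c2 (run c1 st).
Proof. by []. Qed.

Lemma run_seqs0 st : run (seqs [::]) st = st.
Proof. by []. Qed.

Lemma run_seqs c cs st : run (seqs (c :: cs)) st = run (seqs cs) (run c st).
Proof. by []. Qed.

Lemma uses_seqs cs i : uses (seqs cs) i = has (fun c => uses c i) cs.
Proof. by elim: cs => //= c cs ->. Qed.

Lemma loops_seqs cs i : loops (seqs cs) i = has (fun c => loops c i) cs.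
Proof. by elim: cs => //= c cs ->. Qed.

Lemma wf_seqs cs : wf (seqs cs) = all (@wf k) cs.
Proof. by elim: cs => //= c cs ->. Qed.

Lemma uses_emits r s i : uses (emits r s) i -> i = r.
Proof. by rewrite uses_seqs has_map => /hasP[a _ /= /eqP]. Qed.

Lemma loops_emits r s i : ~ loops (emits r s) i.
Proof. by rewrite loops_seqs has_map => /hasP[]. Qed.

Lemma wf_emits r s : wf (emits r s).
Proof. by rewrite wf_seqs all_map; apply/allP. Qed.

Local Opaque emits.

Lemma run_for_app r (b : letter -> cmd k) (f : letter -> seq letter) t st :
  (forall a st', run (b a) st' = app st' t (f a)) ->
  run (For r b) st = app st t (flatten [seq f a | a <- st r]).
Proof.
move=> h /=; elim: (st r) {1 3}st => [|a s IH] st' /=; first by rewrite app_nil.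
by rewrite h IH app_app.
Qed.

Lemma wf_for r (b : letter -> cmd k) :
  (forall a, wf (b a)) -> (forall a i, uses (b a) i -> i != r) -> wf (For r b).
Proof.
move=> w u /=; apply/forallP => a; rewrite w andbT.
by apply/negP => /u; rewrite eqxx.
Qed.

(** * Printing a staged automaton *)

Section Emission.

Variables (W V out : 'I_k.+1).
Hypothesis distinct : uniq [:: W; V; out].

Lemma distinctE : [/\ W != V, W != out & V != out].
Proof.
by move: distinct; rewrite /= !inE negb_or andbT => /andP[/andP[]].
Qed.

Definition outputs (s : seq bool) : cmd k := emits out (map inl s).

Definition repeat_output (r : 'I_k.+1) (s : seq bool) : cmd k :=
  For r (fun=> outputs s).

Lemma run_outputs s st : run (outputs s) st = app st out (map inl s).
Proof. exact: run_emits. Qed.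

Lemma uses_repeat_output r s i :
  uses (repeat_output r s) i -> i = r \/ i = out.
Proof. by case/orP => [/eqP|/existsP[_ /uses_emits]]; [left|right]. Qed.

Lemma loops_repeat_output r s i : loops (repeat_output r s) i -> i = r.
Proof. by case/orP => [/eqP//|/existsP[_ /loops_emits]]. Qed.

Lemma wf_repeat_output r s : r != out -> wf (repeat_output r s).
Proof.
move=> ro; apply: wf_for => [a|a i /uses_emits->]; first exact: wf_emits.
by rewrite eq_sym.
Qed.

Lemma run_repeat_output r n st : run (repeat_output r (nseq n true)) st =
  app st out (map inl (nseq (n * size (st r)) true)).
Proof.
have h (a : letter) st' : run (outputs (nseq n true)) st' =
    app st' out (map inl (nseq n true)).
  exact: run_outputs.
rewrite /repeat_output (@run_for_app r _ _ _ _ h).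
  congr app; elim: (st r) => [|a s IH] /=; first by rewrite muln0.
  by rewrite IH mulnS -map_cat nseqD.
Qed.

Local Opaque repeat_output.

(** The tape [V] holds in unary the number at which the current stage begins. *)
Definition output_num (c : nat) : cmd k :=
  Seq (repeat_output V (nseq 1 true)) (outputs (enc_nat c)).

Lemma run_output_num c st :
  run (output_num c) st = app st out (map inl (enc_nat (size (st V) + c))).
Proof.
rewrite /output_num run_seq run_repeat_output run_outputs app_app mul1n -map_cat.
by rewrite /enc_nat nseqD rcons_cat.
Qed.

Variables (A Q : finType) (ea : A -> seq bool).

Definition output_rule (e : nat) (r : Q * A * Q) : cmd k :=
  seqs [:: outputs [:: true]; output_num (enum_rank r.1.1); outputs (ea r.1.2);
           output_num (e + enum_rank r.2)].

Lemma run_output_rule e (u : Q * A * Q) st : run (output_rule e u) st =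
  app st out (map inl (true :: enc_rule ea (shift (size (st V)) e u))).
Proof.
have [_ _ Vo] := distinctE.
rewrite 4!run_seqs run_seqs0 2!run_output_num 2!run_outputs !app_other //.
rewrite !app_app -!map_cat /enc_rule /enc_pair /shift /=.
by rewrite -!catA.
Qed.

Definition output_rules (e : nat) (rs : seq (Q * A * Q)) : cmd k :=
  seqs [seq output_rule e u | u <- rs].

Lemma run_output_rules e rs st : run (output_rules e rs) st =
  app st out (map inl (enc_items (enc_rule ea) (map (shift (size (st V)) e) rs))).
Proof.
have [_ _ Vo] := distinctE.
elim: rs st => [|u rs IH] st; first by rewrite app_nil.
rewrite /output_rules map_cons run_seqs -/(output_rules e rs) IH.
by rewrite !run_output_rule app_app -map_cat app_other.
Qed.

Variables (R0 RE : Q -> A -> Q -> bool) (RD : letter -> Q -> A -> Q -> bool).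
Variables (q0 qf : Q).

Definition output_stage (a : letter) : cmd k :=
  Seq (output_rules (width Q) (rules (RD a))) (emits V (nseq (width Q) (inl true))).

(** The layout of [enc_staged]: a loop over [W] prints [width Q * size W] in unary and a constant
    completes the number. The last [true] of the first constant opens the list of final states. *)
Definition output_nfa : cmd k :=
  seqs [:: repeat_output W (nseq (width Q) true);
    outputs (enc_nat #|Q|.+1 ++ true :: enc_nat (enum_rank q0) ++ [:: false; true]);
    repeat_output W (nseq (width Q) true);
    outputs (enc_nat (enum_rank qf) ++ [:: false]);
    output_rules 0 (rules R0); For W output_stage; output_rules 0 (rules RE);
    outputs [:: false]].

(** The loop prints the stages of [chain]; the rules [RE] that end it are left to a later
    command. *)
Lemma run_stages (s : seq letter) m st : size (st V) = m ->
  exists y, foldl (fun st' a => run (output_stage a) st') st s =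
    app (app st V (nseq (width Q * size s) (inl true))) out (map inl y) /\
    enc_items (enc_rule ea) (chain RE RD m s) =
    y ++ enc_items (enc_rule ea)
           (map (shift (m + width Q * size s) 0) (rules RE)).
Proof.
have [_ _ Vo] := distinctE.
elim: s m st => [|a s IH] m st sz.
  by exists [::]; rewrite !muln0 !addn0 !app_nil.
have [|y [Ey1 Ey2]] := IH (m + width Q) (run (output_stage a) st).
  rewrite /output_stage run_seq run_output_rules run_emits app_same app_other //.
  by rewrite size_cat size_nseq sz.
eexists; split.
  apply: etrans Ey1 _.
  rewrite /output_stage run_seq run_output_rules run_emits sz.
  rewrite app_app -nseqD -mulnS [app (app st out _) V _]appC 1?eq_sym //.
  by rewrite app_app -map_cat.
by rewrite /= enc_items_cat Ey2 catA mulnS addnA.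
Qed.

Lemma run_output_nfa st : st V = [::] ->
  run output_nfa st = app (app st V (nseq (width Q * size (st W)) (inl true))) out
    (map inl (enc_nfa ea (staged R0 RE RD q0 qf (st W)))).
Proof.
have [WV Wo Vo] := distinctE => V0.
rewrite /output_nfa 8!run_seqs run_seqs0.
rewrite 2!run_repeat_output 3!run_outputs 2!run_output_rules.
rewrite !(app_other _ _ Wo, app_other _ _ Vo, app_app) V0.
set st1 := app st out _.
have st1W : st1 W = st W by rewrite app_other.
have st1V : size (st1 V) = 0 by rewrite app_other // V0.
have [y [Ey1 Ey2]] := run_stages (st W) st1V.
have -> : run (For W output_stage) st1 =
    app (app st1 V (nseq (width Q * size (st W)) (inl true))) out (map inl y).
  by rewrite -Ey1 -st1W.
rewrite app_other // app_same size_cat st1V size_nseq !app_app.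
rewrite /st1 [app (app st out _) V _]appC 1?eq_sym // !app_app -!map_cat.
rewrite enc_staged enc_items_cat Ey2 !add0n; congr app; congr map.
rewrite -addnS !enc_natD -?catA /= -?catA /=.
by rewrite -?catA.
Qed.

Lemma uses_output_rules e rs i : uses (output_rules e rs) i -> i = V \/ i = out.
Proof.
rewrite uses_seqs has_map => /hasP[u _] /=.
have num c : uses (output_num c) i -> i = V \/ i = out.
  by rewrite /= => /orP[/uses_repeat_output|/uses_emits]; auto.
by case/or4P => [/uses_emits|/num|/uses_emits|/orP[/num|]] //; auto.
Qed.

Lemma loops_output_rules e rs i : loops (output_rules e rs) i -> i = V.
Proof.
rewrite loops_seqs has_map => /hasP[u _] /=.
have num c : loops (output_num c) i -> i = V.
  by by rewrite /= => /orP[/loops_repeat_output|/loops_emits].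
by case/or4P => [/loops_emits|/num|/loops_emits|/orP[/num|]].
Qed.

Lemma wf_output_rules e rs : wf (output_rules e rs).
Proof.
have [_ _ Vo] := distinctE.
rewrite wf_seqs all_map; apply/allP => u _.
by rewrite /= /outputs !wf_repeat_output // !wf_emits.
Qed.

Lemma loops_output_nfa i : loops output_nfa i -> i = W \/ i = V.
Proof.
have rep s : loops (repeat_output W s) i -> i = W := @loops_repeat_output _ _ _.
have stg : loops (For W output_stage) i -> i = W \/ i = V.
  rewrite /= => /orP[/eqP|/existsP[a /orP[/loops_output_rules|/loops_emits]]//]; auto.
rewrite /= => /or4P[/rep|/loops_emits|/rep|/or4P[/loops_emits|/loops_output_rules|/stg|]];
  auto.
by case/orP => [/loops_output_rules|/orP[/loops_emits|]] //; auto.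
Qed.

Lemma wf_output_nfa : wf output_nfa.
Proof.
have [WV Wo Vo] := distinctE.
have rep s : wf (repeat_output W s).
  exact: wf_repeat_output.
have stg : wf (For W output_stage).
  apply: wf_for => [a|a i]; first by rewrite /= wf_output_rules wf_emits.
  by rewrite /= => /orP[/uses_output_rules[->|->]|/uses_emits->]; rewrite eq_sym.
rewrite [wf _]/= -/(wf (For W output_stage)) stg /outputs.
by rewrite !rep !wf_emits !wf_output_rules.
Qed.

End Emission.

(** * Computing the padded initial word *)

Section Preparation.

Variables (x W : 'I_k.+1) (X : nat -> 'I_k.+1) (C d : nat).
Let Xs := [seq X j | j <- iota 0 d].
Hypothesis distinct : uniq [:: x, W & Xs].

Lemma preparation_distinct : [/\ x != W, x \notin Xs, W \notin Xs & uniq Xs].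
Proof.
by move: distinct; rewrite /= inE negb_or => /andP[/andP[-> ->] /andP[-> ->]].
Qed.

Lemma mem_Xs j : j < d -> X j \in Xs.
Proof. by move=> jd; apply: map_f; rewrite mem_iota. Qed.

(** Nested loops must run over distinct tapes, so [d] copies of the input are made to iterate
    [size x ^ d] times. *)
Definition copy_input : cmd k :=
  For x (fun a => seqs [seq Emit r a | r <- Xs]).

Fixpoint nest (j : nat) : cmd k :=
  if j is j'.+1 then For (X j') (fun=> nest j')
  else emits W (nseq C (inr false)).

Definition pad : cmd k := Seq (nest d) (emits W (nseq (C + 4) (inr false))).

Definition prepare : cmd k :=
  seqs [:: copy_input; pad; Emit W (inr true); For x (fun a => Emit W a); pad].

Lemma run_copy_input st i :
  run copy_input st i = st i ++ (if i \in Xs then st x else [::]).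
Proof.
have [_ _ _ uX] := preparation_distinct.
(* The number of appended letters is a truth value: since the list is duplicate-free, no tape
   receives a letter twice. *)
have body a st' :
    run (seqs [seq Emit r a | r <- Xs]) st' i = st' i ++ nseq (i \in Xs) a.
  elim: (Xs) uX st' => [|r l IH] /= => [_ st'|]; first by rewrite cats0.
  move=> /andP[nr ul] st'; rewrite IH // inE ffunE.
  by case: eqP => [->|_] //; rewrite (negbTE nr) /= cats0.
rewrite /=; elim: (st x) {1 3}st => [|a s IH] st' /=.
  by rewrite if_same cats0.
by rewrite IH body -catA; case: (i \in Xs).
Qed.

Lemma run_nest n j st : j <= d -> (forall m, m < d -> size (st (X m)) = n) ->
  run (nest j) st = app st W (nseq (C * n ^ j) (inr false)).
Proof.
have [_ _ WX _] := preparation_distinct.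
elim: j st => [|j IH] st jd sz; first by rewrite run_emits expn0 muln1.
rewrite /= expnS -[X in _ * (X * _)](sz j jd); move: (st (X j)) => s0.
elim: s0 st sz => [|a s IHs] st sz /=; first by rewrite muln0 app_nil.
rewrite IH 1?ltnW // IHs => [|m md]; first by rewrite app_app -nseqD -mulnDr -mulSn.
by rewrite app_other ?sz //; apply: contraNneq WX => <-; apply: mem_Xs.
Qed.

Lemma run_pad n st : (forall m, m < d -> size (st (X m)) = n) ->
  run pad st = app st W (nseq (C * n ^ d + (C + 4)) (inr false)).
Proof.
by move=> sz; rewrite /pad run_seq (run_nest _ sz) // run_emits app_app -nseqD.
Qed.

Lemma run_prepare st (w : seq bool) : st x = map inl w -> st W = [::] ->
  (forall i, i \in Xs -> st i = [::]) ->
  forall i, run prepare st i =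
    if i == W then init_word w (C * size w ^ d + (C + 4))
    else if i \in Xs then map inl w else st i.
Proof.
have [xW xX WX _] := preparation_distinct => sx sW sX i.
set st1 := run copy_input st.
have sz s m : m < d -> size (app st1 W s (X m)) = size w.
  move=> /mem_Xs mX; rewrite app_other; last by apply: contraNneq WX => <-.
  by rewrite run_copy_input mX sX // sx size_map.
have pads s : run pad (app st1 W s) =
    app st1 W (s ++ nseq (C * size w ^ d + (C + 4)) (inr false)).
  by rewrite (run_pad (sz s)) app_app.
have copies s : run (For x (fun a => Emit W a)) (app st1 W s) =
    app st1 W (s ++ map inl w).
  rewrite (@run_for_app x _ (fun a => [:: a]) W) // app_app app_other //.
  by rewrite run_copy_input (negbTE xX) cats0 sx flatten_seq1.
have st1E : st1 = app st1 W [::] by rewrite app_nil.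
have emitS s : run (Emit W (inr true)) (app st1 W s) = app st1 W (rcons s (inr true)).
  by rewrite /= app_app cats1.
rewrite /prepare 5!run_seqs run_seqs0 -/st1 st1E pads emitS copies pads ffunE.
rewrite run_copy_input; case: eqP => [->|_].
  by rewrite sW (negbTE WX) /init_word cat_rcons -!catA.
by case: ifP => [/sX->|]; rewrite ?sx ?cats0.
Qed.

Lemma wf_prepare : wf prepare.
Proof.
have [xW xX WX uX] := preparation_distinct.
have usesX j i : j <= d -> uses (nest j) i -> i = W \/ exists2 m, m < j & i = X m.
  elim: j => [|j IH] jd; first by move/uses_emits; left.
  rewrite /= => /orP[/eqP->|/existsP[_ /(IH (ltnW jd))]].
    by right; exists j.
  by case=> [|[m mj ->]]; [left|right; exists m => //; apply: ltnW].
have wn j : j <= d -> wf (nest j).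
  elim: j => [|j IH] jd; first exact: wf_emits.
  apply: wf_for => [_|_ i /(usesX _ _ (ltnW jd))]; first exact/IH/ltnW.
  case=> [->|[m mj ->]].
    by apply: contraNneq WX => ->; apply: mem_Xs.
  have XE m' : m' < d -> X m' = nth x Xs m'.
    by move=> md; rewrite (nth_map 0) ?size_iota // nth_iota.
  rewrite !XE ?(ltn_trans mj) // nth_uniq ?size_map ?size_iota ?(ltn_trans mj) //.
  by rewrite ltn_eqF.
have wpad : wf pad by rewrite /= wn // wf_emits.
have wc : wf copy_input.
  apply: wf_for => [a|a i]; first by rewrite wf_seqs all_map; apply/allP.
  rewrite uses_seqs has_map => /hasP[r rX /= /eqP->].
  by apply: contraNneq xX => <-.
have we : wf (For x (fun a => Emit W a)).
  by apply: wf_for => // a i /= /eqP->; rewrite eq_sym.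
have -> : wf prepare = [&& wf copy_input, wf pad, true,
    wf (For x (fun a => Emit W a)), wf pad & true] by [].
by rewrite wc we wpad.
Qed.

Lemma loops_prepare i : loops prepare i -> i = x \/ i \in Xs.
Proof.
have ln j : j <= d -> loops (nest j) i -> i \in Xs.
  elim: j => [|j IH] jd; first by move/loops_emits.
  rewrite /= => /orP[/eqP->|/existsP[_ /(IH (ltnW jd))]//]; exact: mem_Xs.
have lp : loops pad i -> i \in Xs.
  by rewrite /= => /orP[/(ln _ (leqnn _))|/loops_emits].
have lc a : ~ loops (seqs [seq Emit r a | r <- Xs]) i.
  by rewrite loops_seqs has_map => /hasP[].
case/or4P => [/orP[/eqP|/existsP[a /lc]]|/lp|//|]; auto.
by case/orP => [/orP[/eqP|/existsP[]]|/orP[/lp|]] //; auto.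
Qed.

End Preparation.

End Programs.

(** * The reduction *)

Section Reduction.

Variables (M : tm 0) (c d : nat).

(** The constant [4] gives [s.+1 < o] for the space bound [s = c * n ^ d + c + 2]. *)
Definition padding (n : nat) : nat := c * n ^ d + (c + 4).

(** Tape [0] is the input, [1] the initial word, [2] to [4] the counters of the three automata,
    which must each start empty, the next [d] tapes the copies of the input, and [d + 5] the
    output. *)
Definition reduction_tape (j : nat) : 'I_(d + 5).+1 := inord j.

Notation tape_in := (@ord0 (d + 5)).
Notation tape_out := (@ord_max (d + 5)).
Notation tape_word := (reduction_tape 1).
Notation tape_copy := (fun j => reduction_tape (5 + j)).

Notation enc_letter := (@enc_ord #|{: option (cell M)}|).

Definition reduction_cmd : cmd (d + 5) :=
  seqs [:: prepare tape_in tape_word tape_copy c d;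
    outputs tape_out (enc_nat #|{: option (cell M)}|);
    output_nfa tape_word (reduction_tape 2) tape_out enc_letter
      (@I_start (alphabet M)) (I_end (ok M)) (fun=> @I_rule (alphabet M)) tt tt;
    output_nfa tape_word (reduction_tape 3) tape_out (enc_pair enc_letter enc_letter)
      (@T_start (alphabet M)) (T_end (ok M)) (fun=> T_rule (@check M))
      (inl (inl (inl false))) (inl (inl (inl true)));
    output_nfa tape_word (reduction_tape 4) tape_out enc_letter
      (@U_start (alphabet M)) (U_end (ok M) (@rejecting M))
      (U_rule (@word_letter M)) false true].

Lemma reduction_tape_eq i j : i < d + 6 -> j < d + 6 ->
  (reduction_tape i == reduction_tape j) = (i == j).
Proof. by move=> id jd; rewrite -val_eqE /= !inordK; lia. Qed.

Lemma tape_inE : tape_in = reduction_tape 0.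
Proof. by apply: val_inj; rewrite /= inordK. Qed.

Lemma tape_outE : tape_out = reduction_tape (d + 5).
Proof. by apply: val_inj; rewrite /= inordK; lia. Qed.

Lemma prepare_uniq :
  uniq [:: tape_in, tape_word & [seq tape_copy j | j <- iota 0 d]].
Proof.
have nin i : i < 5 -> reduction_tape i \notin [seq tape_copy j | j <- iota 0 d].
  move=> i5; apply/mapP => -[j]; rewrite mem_iota => /andP[_ jd] /eqP.
  by rewrite reduction_tape_eq; lia.
rewrite /= inE negb_or tape_inE reduction_tape_eq; [|lia|lia].
rewrite !nin //= map_inj_in_uniq ?iota_uniq // => i j.
rewrite !mem_iota => id jd /eqP; rewrite reduction_tape_eq; lia.
Qed.

Lemma output_uniq j : 2 <= j < 5 -> uniq [:: tape_word; reduction_tape j; tape_out].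
Proof.
move=> jb; rewrite tape_outE /= !inE !reduction_tape_eq; lia.
Qed.

Lemma wf_reduction : wf reduction_cmd.
Proof.
rewrite /reduction_cmd wf_seqs.
apply/and5P; split; first exact: wf_prepare prepare_uniq.
- exact: wf_emits.
- by apply: wf_output_nfa; apply: output_uniq.
- by apply: wf_output_nfa; apply: output_uniq.
by apply/andP; split=> //; apply: wf_output_nfa; apply: output_uniq.
Qed.

Definition width_sum : nat :=
  width unit + width (T_state (alphabet M)) + width bool.

(** The output is never looped over, so only the other tapes need a bound: the input and its copies,
    the word, and the counters, each a constant multiple of the word. *)
Lemma run_reduction (x : seq bool) :
  let st := run reduction_cmd (input_store _ x) in
  st tape_out = map inl (enc_instance (reduced M x (padding (size x)))) /\
  forall i, i != tape_out -> size (st i) <=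
    size x + (2 * padding (size x) + size x).+1 * width_sum.+1.
Proof.
move=> st; pose st0 := input_store (d + 5) x.
set o := padding (size x).
have neq i j : i < d + 6 -> j < d + 6 -> i != j ->
  reduction_tape i != reduction_tape j by move=> *; rewrite reduction_tape_eq.
have in0 i : i != tape_in -> st0 i = [::] by rewrite ffunE => /negbTE->.
have wi : tape_word != tape_in by rewrite tape_inE neq; lia.
have p : forall i, run (prepare tape_in tape_word tape_copy c d) st0 i =
    if i == tape_word then init_word x o
    else if i \in [seq tape_copy j | j <- iota 0 d] then map inl x else st0 i.
  move=> i; apply: (run_prepare c prepare_uniq); first by rewrite ffunE eqxx.
    exact: in0.
  move=> {}i /mapP[j]; rewrite mem_iota => jd ->; apply: in0.
  by rewrite tape_inE neq; lia.
set st1 := run _ st0 in p.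
have e1 i : i \notin [:: tape_in; tape_word] ->
    i \notin [seq tape_copy j | j <- iota 0 d] -> st1 i = [::].
  rewrite p !inE negb_or => /andP[i0 /negbTE->] /negbTE->; exact: in0.
have nX i : i < 5 \/ i = d + 5 ->
    reduction_tape i \notin [seq tape_copy j | j <- iota 0 d].
  move=> i5; apply/mapP => -[j]; rewrite mem_iota => /andP[_ jd] /eqP.
  by rewrite reduction_tape_eq; lia.
have e2 i : 2 <= i < 5 \/ i = d + 5 -> st1 (reduction_tape i) = [::].
  move=> ib; apply: e1; last by apply: nX; lia.
  by rewrite !inE tape_inE negb_or !neq; lia.
have no i : 1 <= i < 5 -> reduction_tape i != tape_out.
  by move=> ib; rewrite tape_outE neq; lia.
have nt i j : i < 5 -> j < 5 -> i != j -> reduction_tape i != reduction_tape j.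
  by move=> *; rewrite neq //; lia.
have stage (Q : finType) (A : finType) ea R0 RE RD q0 qf j (st' : store (d + 5)) :
    2 <= j < 5 -> st' (reduction_tape j) = [::] -> st' tape_word = init_word x o ->
  run (@output_nfa _ tape_word (reduction_tape j) tape_out A Q ea R0 RE RD q0 qf) st' =
  app (app st' (reduction_tape j) (nseq (width Q * size (init_word x o)) (inl true)))
    tape_out (map inl (enc_nfa ea (staged R0 RE RD q0 qf (init_word x o)))).
  by move=> jb e <-; rewrite run_output_nfa //; apply: output_uniq.
have E : st = app (app (app (app (app (app (app st1 tape_out
    (map inl (enc_nat #|{: option (cell M)}|)))
    (reduction_tape 2) (nseq (width unit * size (init_word x o)) (inl true)))
    tape_out (map inl (enc_nfa enc_letter (init_nfa (ok M) (init_word x o)))))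
    (reduction_tape 3)
      (nseq (width (T_state (alphabet M)) * size (init_word x o)) (inl true)))
    tape_out (map inl (enc_nfa (enc_pair enc_letter enc_letter)
      (step_nfa (ok M) (@check M) (init_word x o)))))
    (reduction_tape 4) (nseq (width bool * size (init_word x o)) (inl true)))
    tape_out (map inl (enc_nfa enc_letter
      (final_nfa (ok M) (@word_letter M) (@rejecting M) (init_word x o)))).
  rewrite /st /reduction_cmd 5!run_seqs run_seqs0 -/st0 -/st1 run_outputs.
  have word : st1 tape_word = init_word x o by rewrite p eqxx.
  rewrite [X in run _ (run _ X) = _]stage => [|//||].
  - rewrite [X in run _ X = _]stage => [|//||].
    + rewrite stage => [//|//||].
      * by rewrite !app_other ?no ?nt // e2; auto.
      by rewrite !app_other ?no ?nt.
    + by rewrite !app_other ?no ?nt // e2; auto.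
    by rewrite !app_other ?no ?nt.
  - by rewrite app_other ?no // e2; auto.
  by rewrite app_other ?no.
split.
  have o1 : st1 tape_out = [::] by rewrite tape_outE e2; auto.
  rewrite E !ffunE eqxx !ifF ?eqxx; try by rewrite eq_sym; apply/negbTE/no.
  by rewrite o1 cat0s -!map_cat /enc_instance -!catA.
move=> i io; rewrite E !(app_other _ _ io).
have sz1 : size (st1 i) <= size x + size (init_word x o).
  rewrite p; case: ifP => _; first exact: leq_addl.
  case: ifP => _; first by rewrite size_map leq_addr.
  by rewrite ffunE; case: ifP => _ //; rewrite size_map leq_addr.
have app_le (st' : store (d + 5)) j s : size (app st' j s i) <= size (st' i) + size s.
  by rewrite ffunE; case: ifP => _; rewrite ?size_cat ?leq_addr.
apply: leq_trans (app_le _ _ _) _; rewrite (app_other _ _ io).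
apply: leq_trans (leq_add (app_le _ _ _) (leqnn _)) _; rewrite (app_other _ _ io).
apply: leq_trans (leq_add (leq_add (app_le _ _ _) (leqnn _)) (leqnn _)) _.
rewrite (app_other _ _ io) !size_nseq -/(period x o).
move: sz1; rewrite size_init_word /width_sum; move: (period x o).+1 => m sz1.
by rewrite mulnS !mulnDr !(mulnC m) !addnA !leq_add2r.
Qed.

Lemma loops_reduction i : loops reduction_cmd i -> i != tape_out.
Proof.
have no j : j < d + 5 -> reduction_tape j != tape_out.
  by move=> jb; rewrite tape_outE reduction_tape_eq; lia.
rewrite /reduction_cmd loops_seqs.
case/or4P => [|/loops_emits|/loops_output_nfa[]->|
  /or3P[/loops_output_nfa[]->|/loops_output_nfa[]->|]] //;
  try by apply: no; lia.
case/loops_prepare => [->|/mapP[j]]; first by rewrite tape_inE no; lia.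
by rewrite mem_iota => jd ->; apply: no; lia.
Qed.

Lemma poly_bounded_padding : poly_bounded padding.
Proof.
apply: poly_bounded_add (poly_bounded_const _).
apply: poly_bounded_mul (poly_bounded_const _) _.
exact: poly_bounded_exp poly_bounded_id.
Qed.

Lemma reduction_polytime :
  polytime (fun x => enc_instance (reduced M x (padding (size x)))).
Proof.
pose p n := n + (2 * padding n + n).+1 * width_sum.+1.
have pp : poly_bounded p.
  apply: poly_bounded_add poly_bounded_id _.
  apply: poly_bounded_mul (poly_bounded_const _).
  apply: (poly_bounded_add (poly_bounded_const 1)).
  apply: poly_bounded_add poly_bounded_id.
  exact: poly_bounded_mul (poly_bounded_const 2) poly_bounded_padding.
apply: (run_polytime wf_reduction pp) => [x|x i /loops_reduction io].
  by have [] := run_reduction x.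
by have [_ /(_ i io)] := run_reduction x.
Qed.

End Reduction.

Theorem lemma6p1 : PSPACE_hard (language_of enc_instance IndInv1_disjoint).
Proof.
move=> L [M [c [d H]]].
exists (fun x => enc_instance (reduced M x (padding c d (size x)))).
  exact: reduction_polytime.
move=> x; have [[t [b [tb bL]]] space] := H x.
(* The summand [2] provides the lower bound [2 <= s] required by the diagram. *)
have space' i : size (tape_cells (ctapes (tm_run M x i) ord0)) <= c * size x ^ d + c + 2.
  by apply: leq_trans (space i) _; rewrite leq_addr.
have red := reducedP space' (o := padding c d (size x)).
(* Halting configurations are fixed, so the verdict [b] reached at time [t] is the only one;
   membership in [L] means never rejecting. *)
have -> : L x <-> ~ exists i, tm_verdict (st M x i) = Some false.
  have halt i j v : tm_verdict (st M x i) = Some v -> st M x (i + j) = st M x i.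
    move=> hv; suff E : tm_run M x (i + j) = tm_run M x i by rewrite /st E.
    rewrite /tm_run addnC iterD; elim: j => //= j ->.
    by rewrite /tm_step; move: hv; rewrite /st /tm_run => ->.
  have uniq i : tm_verdict (st M x i) = Some false -> b = false.
    move=> hi; have := halt i t _ hi; rewrite addnC (halt t i _ tb) => E.
    by move: hi; rewrite -E tb => -[].
  rewrite -bL; split=> [bt [i /uniq bf]|ne]; first by rewrite bf in bt.
  by case: b tb bL uniq => // tb _ _; case: ne; exists t.
rewrite -red; [|rewrite /padding; lia|lia].
split=> [h|[y /enc_instance_inj ->]//]; by exists (reduced M x (padding c d (size x))).
Qed.
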